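(* Let $(M,g)$ be a connected $2$-dimensional spin manifold of signature $(0,2)$ (i.e. with $g$ positive-definite, in the convention of the context) or a connected $2$-dimensional time-orientable spin manifold of Lorentzian signature $(1,1)$. Let $B$ be an admissible bilinear on the irreducible pinor module $S=\mathsf{S}$ (of which there are two, distinguished by $\varsigma_B=\pm1$), let $\kappa$ be the corresponding Dirac current, and let $\underline{S}$ be the spinor bundle associated to $S$. Let $b\in C^\infty(M)$ and define $\beta\in\Omega^1(M;\operatorname{End}\underline{S})$ by $$\beta(X)\epsilon=\begin{cases} b\,X\cdot\epsilon & \text{if }\varsigma_B=-1,\\ b\,( *X)\cdot\epsilon&\text{if }\varsigma_B=+1.\end{cases}$$ Then $D=\nabla-\beta$ is an admissible connection on $\underline{S}$.
   Context: Conventions. The Clifford relation is $v\cdot v=+\eta(v,v)\mathbb{1}$. ''Signature $(0,2)$'' means $V=\mathbb{R}^2$ with positive-definite $\eta$ and oriented orthonormal basis $e_1,e_2$; signature $(1,1)$ means $V=\mathbb{R}^2$ with oriented orthonormal basis $e_0,e_1$, $\eta_{00}=-1$, $\eta_{11}=1$. With $\sigma_1=\begin{pmatrix}0&1\\1&0\end{pmatrix}$, $\sigma_3=\begin{pmatrix}1&0\\0&-1\end{pmatrix}$, $\Omega=\begin{pmatrix}0&1\\-1&0\end{pmatrix}$, the pinor module is $\mathsf{S}=\mathbb{R}^2$ with $e_\mu$ acting by $\Gamma_\mu$: in signature $(1,1)$, $\Gamma_0=\Omega$, $\Gamma_1=\sigma_1$; in signature $(0,2)$, $\Gamma_1=\sigma_3$,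 $\Gamma_2=\sigma_1$. The admissible bilinears are: in signature $(1,1)$, $\epsilon^T\sigma_1\epsilon'$ (symmetric, $\varsigma_B=+1$) and $\epsilon^T\Omega\epsilon'$ (skew, $\varsigma_B=-1$); in signature $(0,2)$, $\epsilon^T\epsilon'$ ($\varsigma_B=+1$) and $\epsilon^T\Omega\epsilon'$ ($\varsigma_B=-1$). $\varepsilon_{\mu\nu}$ is antisymmetric with $\varepsilon_{01}=1$ (resp. $\varepsilon_{12}=1$), and the Hodge star on vectors is $*e_\mu=\varepsilon_{\mu\nu}e^\nu$ in oriented orthonormal frames (indices raised with the metric). Fix a spin structure $P\to M$ and let $\underline{S}=P\times_{\mathrm{Spin}(V)}\mathsf{S}$, $\mathfrak{S}=\Gamma(\underline{S})$. $\nabla$ is the Levi-Civita connection and its lift to $\underline{S}$. $B$ induces a $\nabla$-parallel bilinear form $\langle-,-\rangle$ on $\underline{S}$, and the Dirac current $\kappa\colon\operatorname{Sym}^2\underline{S}\to TM$ is defined by $g(\kappa(\epsilon,\epsilon'),X)=\langle\epsilon,X\cdot\epsilon'\rangle$; $\kappa_\epsilon=\kappa(\epsilon,\epsilon)$. $\mathfrak{so}(M,g)$ denotes the $g$-skew-symmetric endomorphism fields of $TM$; $A\in\mathfrak{so}(M,g)$ acts on spinors by $A\cdot\epsilon=\tfrac14A_{\mu\nu}\Gamma^{\mu\nu}\epsilon$ with $A_{\mu\nu}=g(e_\mu,Ae_\nu)$, $\Gamma^{\mu\nu}=\Gamma^{[\mu}\Gamma^{\nu]}$. For a Killing vector $X$,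 the spinorial Lie derivative is $\mathscr{L}_X\epsilon=\nabla_X\epsilon-(\nabla X)\cdot\epsilon$, and $(\mathscr{L}_X\beta)(Y)\epsilon=\mathscr{L}_X(\beta(Y)\epsilon)-\beta([X,Y])\epsilon-\beta(Y)\mathscr{L}_X\epsilon$. Admissible connection. A connection $D=\nabla-\beta$ on $\underline{S}$, $\beta\in\Omega^1(M;\operatorname{End}\underline{S})$, is admissible if: (1) the section $\gamma$ of $\operatorname{Hom}(\operatorname{Sym}^2\underline{S},\operatorname{End}(TM))$ given by $\gamma(\epsilon,\epsilon)X=-2\kappa(\epsilon,\beta(X)\epsilon)$ satisfies $\gamma(\epsilon,\epsilon)\in\mathfrak{so}(M,g)$ for all $\epsilon\in\mathfrak{S}$; (2) $\beta(\kappa_\epsilon)\epsilon+\gamma(\epsilon,\epsilon)\cdot\epsilon=0$ for all $\epsilon\in\mathfrak{S}$; (3) $\mathscr{L}_{\kappa_\epsilon}\beta=0$ for all $\epsilon\in\mathfrak{S}_D=\{\epsilon\in\mathfrak{S}\mid D\epsilon=0\}$. (Condition (1) implies that $\kappa_\epsilon$ is a Killing vector for $\epsilon\in\mathfrak{S}_D$, so (3) makes sense.) *)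

(* Defs.v *)
From HB Require Import structures.
From mathcomp Require Import all_boot all_order all_algebra.
From mathcomp Require Import all_classical all_reals all_analysis.

Set Implicit Arguments.
Unset Strict Implicit.
Unset Printing Implicit Defensive.

Import Order.TTheory GRing.Theory Num.Theory.
Import numFieldNormedType.Exports.

Local Open Scope classical_set_scope.
Local Open Scope ring_scope.

(** ** Smooth surfaces *)

Definition ebase (R : realType) (k : 'I_2) : 'cV[R]_2 := delta_mx k 0.

Fixpoint Ck (R : realType) (n : nat) (O : set 'cV[R]_2) (f : 'cV[R]_2 -> R)
    : Prop :=
  match n with
  | 0 => forall x, O x -> {for x, continuous f}
  | n'.+1 => (forall x, O x -> differentiable f x) /\
             (forall k, Ck n' O ('D_(ebase R k) f))
  end.

Definition Cinfty (R : realType) (O : set 'cV[R]_2) (f : 'cV[R]_2 -> R) :=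
  forall n, Ck n O f.

(* A two-dimensional smooth manifold given by a smooth atlas.  [chart a] and
   [param a] are mutually inverse homeomorphisms between the open sets [dom a]
   and [chart a @` dom a]; their values elsewhere are irrelevant.  As in
   charted spaces, [chart_at m] is a preferred chart around m; it is used to
   identify T_m M with R^2. *)
Record surface (R : realType) := Surface {
  point :> topologicalType;
  surface_hausdorff : hausdorff_space point;
  surface_second_countable : @second_countable point;
  atlas : Type;
  dom : atlas -> set point;
  chart : atlas -> point -> 'cV[R]_2;
  param : atlas -> 'cV[R]_2 -> point;
  chart_at : point -> atlas;
  dom_chart_at : forall m, dom (chart_at m) m;
  dom_open : forall a, open (dom a);
  image_open : forall a, open (chart a @` dom a);
  chartK : forall a m, dom a m -> param a (chart a m) = m;
  chart_continuous : forall a m, dom a m -> {for m, continuous (chart a)};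
  param_continuous : forall a x, (chart a @` dom a) x ->
    {for x, continuous (param a)};
  transition_smooth : forall a b (i : 'I_2),
    Cinfty (chart a @` (dom a `&` dom b))
      (fun x => chart b (param a x) i 0)
}.

Definition smooth_on (R : realType) (M : surface R) (W : set M) (f : M -> R) :=
  forall a : atlas M, Cinfty (chart a @` (dom a `&` W)) (f \o param a).

(* The Jacobian at m of the change of coordinates from a to b. *)
Definition jac (R : realType) (M : surface R) (a b : atlas M) (m : M)
    : 'M[R]_2 :=
  \matrix_(i, k) 'D_(ebase R k) (fun x => chart b (param a x) i 0) (chart a m).

(* A tangent vector at m is represented by its components in [chart_at m], and
   a vector field by a function M -> 'cV_2 whose value at m lies in T_m M (so
   that it is in general not a continuous function). *)
Definition tcoord (R : realType) (M : surface R) (a : atlas M)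
    (X : M -> 'cV[R]_2) (m : M) : 'cV[R]_2 := jac (chart_at m) a m *m X m.

Definition smooth_vf (R : realType) (M : surface R) (W : set M)
    (X : M -> 'cV[R]_2) :=
  forall (a : atlas M) (k : 'I_2),
    smooth_on (W `&` dom a) (fun m => tcoord a X m k 0).

(* df_m(v) *)
Definition dir (R : realType) (M : surface R) (m : M) (v : 'cV[R]_2)
    (f : M -> R) : R :=
  'D_v (f \o param (chart_at m)) (chart (chart_at m) m).

Definition bracket (R : realType) (M : surface R) (X Y : M -> 'cV[R]_2) (m : M)
    : 'cV[R]_2 :=
  \col_k (dir m (X m) (fun m' => tcoord (chart_at m) Y m' k 0)
        - dir m (Y m) (fun m' => tcoord (chart_at m) X m' k 0)).

(** ** The Clifford algebra and the pinor module in the two signatures *)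

Variant signature := Riemannian | Lorentzian.

(* In both signatures the index set is 'I_2: the basis is (e_1, e_2) in the
   Riemannian case and (e_0, e_1) in the Lorentzian one. *)
Definition eta (R : realType) (sg : signature) (mu : 'I_2) : R :=
  match sg with
  | Riemannian => 1
  | Lorentzian => if mu == 0 then -1 else 1
  end.

Definition eta_mx (R : realType) (sg : signature) : 'M[R]_2 :=
  diag_mx (\row_mu eta R sg mu).

Definition mx22 (R : realType) (a b c d : R) : 'M[R]_2 :=
  \matrix_(i, j) if i == 0 then (if j == 0 then a else b)
                 else (if j == 0 then c else d).

Definition sigma1 (R : realType) : 'M[R]_2 := mx22 0 1 1 0.
Definition sigma3 (R : realType) : 'M[R]_2 := mx22 1 0 0 (-1).
Definition Omega (R : realType) : 'M[R]_2 := mx22 0 1 (-1) 0.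

Definition Gam (R : realType) (sg : signature) (mu : 'I_2) : 'M[R]_2 :=
  match sg with
  | Riemannian => if mu == 0 then sigma3 R else sigma1 R
  | Lorentzian => if mu == 0 then Omega R else sigma1 R
  end.

(* Gamma^mu; the metric is diagonal with entries +-1 *)
Definition Gam_up (R : realType) (sg : signature) (mu : 'I_2) : 'M[R]_2 :=
  eta R sg mu *: Gam R sg mu.

Definition Gam_up2 (R : realType) (sg : signature) (mu nu : 'I_2) : 'M[R]_2 :=
  2^-1 *: (Gam_up R sg mu *m Gam_up R sg nu - Gam_up R sg nu *m Gam_up R sg mu).

(* The action on pinors of the skew endomorphism with lowered components A. *)
Definition so_act (R : realType) (sg : signature) (A : 'M[R]_2) : 'M[R]_2 :=
  4^-1 *: \sum_mu \sum_nu A mu nu *: Gam_up2 R sg mu nu.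

(* The Clifford algebra is identified with 'M_2 through the Gamma matrices.
   This is the set of even elements s with s * s~ = 1, where s~ is the reversal
   of s: the group Spin(2) in the Riemannian case, and in the Lorentzian case
   the double cover of the identity component of SO(1,1). *)
Definition Spin (R : realType) (sg : signature) : set 'M[R]_2 :=
  [set s | exists x y : R,
    let w := y *: (Gam R sg 0 *m Gam R sg 1) in
    s = x%:M + w /\ (x%:M + w) *m (x%:M - w) = 1%:M].

(* The covering Spin -> SO, i.e. the matrix of v |-> s v s^-1:
   s Gamma_nu s^-1 = \sum_mu (Ad s)_(mu nu) Gamma_mu, the coefficients being
   extracted by means of tr (Gamma^mu Gamma_nu) = 2 delta^mu_nu. *)
Definition Ad (R : realType) (sg : signature) (s : 'M[R]_2) : 'M[R]_2 :=
  \matrix_(mu, nu)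
    (2^-1 * \tr (Gam_up R sg mu *m (s *m Gam R sg nu *m invmx s))).

(* The sign varsigma_B = +1 (Symmetric) or -1 (Skew). *)
Variant symmetry := Symmetric | Skew.

Definition Bmx (R : realType) (sg : signature) (vs : symmetry) : 'M[R]_2 :=
  match sg, vs with
  | Riemannian, Symmetric => 1%:M
  | Lorentzian, Symmetric => sigma1 R
  | _, Skew => Omega R
  end.

Definition B (R : realType) (sg : signature) (vs : symmetry)
    (e e' : 'cV[R]_2) : R := (e^T *m Bmx R sg vs *m e') 0 0.

Definition epsilon (R : realType) : 'M[R]_2 := mx22 0 1 (-1) 0.

(* Matrix of the Hodge star, acting on components:
   *e_mu = epsilon_(mu nu) eta^(nu nu) e_nu *)
Definition hodge_mx (R : realType) (sg : signature) : 'M[R]_2 :=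
  \matrix_(nu, mu) (epsilon R mu nu * eta R sg nu).

(** ** Metrics and spin structures *)

(* Gram matrix, in the coordinate basis of the chart a, of a bilinear form G
   given in the preferred charts *)
Definition gcoord (R : realType) (M : surface R) (G : M -> 'M[R]_2)
    (a : atlas M) (m : M) : 'M[R]_2 :=
  (jac a (chart_at m) m)^T *m G m *m jac a (chart_at m) m.

Record metric (R : realType) (sg : signature) (M : surface R) := Metric {
  (* the Gram matrix of g_m in the coordinate basis of [chart_at m] *)
  gram :> M -> 'M[R]_2;
  gram_sym : forall m, (gram m)^T = gram m;
  gram_signature : forall m, exists E : 'M[R]_2,
    E^T *m gram m *m E = eta_mx R sg;
  gram_smooth : forall (a : atlas M) (k l : 'I_2),
    smooth_on (dom a) (fun m => gcoord gram a m k l)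
}.

Definition gdot (R : realType) (sg : signature) (M : surface R)
    (g : metric sg M) (m : M) (v w : 'cV[R]_2) : R := (v^T *m g m *m w) 0 0.

(* Christoffel symbols Gamma^k_(i j) of g at m, in [chart_at m] *)
Definition christoffel (R : realType) (sg : signature) (M : surface R)
    (g : metric sg M) (m : M) (k i j : 'I_2) : R :=
  let dg (l i j : 'I_2) :=
    dir m (ebase R l) (fun m' => gcoord g (chart_at m) m' i j) in
  2^-1 * \sum_l invmx (g m) k l * (dg i j l + dg j i l - dg l i j).

(* The Levi-Civita covariant derivative (nabla_v Y)(m), for v in T_m M *)
Definition nabla_vf (R : realType) (sg : signature) (M : surface R)
    (g : metric sg M) (m : M) (v : 'cV[R]_2) (Y : M -> 'cV[R]_2) : 'cV[R]_2 :=
  \col_k (dir m v (fun m' => tcoord (chart_at m) Y m' k 0)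
          + \sum_i \sum_j christoffel g m k i j * v i 0 * Y m j 0).

(* A principal Spin-bundle P -> M with a Spin-equivariant map to the bundle of
   orthonormal frames.  Smoothness is expressed by a bundle atlas of local
   sections.  The frames in the image of P are the oriented (and, in Lorentzian
   signature, time-oriented) orthonormal frames: thus the spin structure
   determines the orientation and the time orientation of M. *)
Record spin_structure (R : realType) (sg : signature) (M : surface R)
    (g : metric sg M) := SpinStructure {
  total :> Type;
  proj : total -> M;
  act : total -> 'M[R]_2 -> total;
  act1 : forall p, act p 1%:M = p;
  actM : forall p s s', Spin sg s -> Spin sg s' ->
    act p (s *m s') = act (act p s) s';
  proj_act : forall p s, Spin sg s -> proj (act p s) = proj p;
  act_simply_transitive : forall p q, proj p = proj q ->
    exists! s, Spin sg s /\ q = act p s;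
  triv : Type;
  tdom : triv -> set M;
  tdom_open : forall t, open (tdom t);
  triv_at : M -> triv;
  tdom_triv_at : forall m, tdom (triv_at m) m;
  sec : triv -> M -> total;
  proj_sec : forall t m, tdom t m -> proj (sec t m) = m;
  sec_transition : forall t u, exists h : M -> 'M[R]_2,
    (forall m, tdom t m -> tdom u m ->
       Spin sg (h m) /\ sec u m = act (sec t m) (h m)) /\
    (forall i j, smooth_on (tdom t `&` tdom u) (fun m => h m i j));
  (* the columns of [frame p] are the vectors e_mu of the frame of
     T_(proj p) M determined by p *)
  frame : total -> 'M[R]_2;
  frame_orthonormal : forall p,
    (frame p)^T *m g (proj p) *m frame p = eta_mx R sg;
  frame_act : forall p s, Spin sg s -> frame (act p s) = frame p *m Ad sg s;
  frame_smooth : forall t mu,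
    smooth_vf (tdom t) (fun m => col mu (frame (sec t m)))
}.

(** ** Spinor fields *)

(* A section of P x_Spin S is represented by the corresponding Spin-equivariant
   function P -> S. *)
Definition spinor_field (R : realType) (sg : signature) (M : surface R)
    (g : metric sg M) (P : spin_structure g) (psi : P -> 'cV[R]_2) :=
  (forall p s, Spin sg s -> psi (act p s) = invmx s *m psi p) /\
  (forall (t : triv P) k, smooth_on (tdom t) (fun m => psi (sec t m) k 0)).

(* X |-> X . , for X in T_(proj p) M *)
Definition cliff (R : realType) (sg : signature) (M : surface R)
    (g : metric sg M) (P : spin_structure g) (p : P) (X : 'cV[R]_2)
    : 'M[R]_2 :=
  \sum_mu (invmx (frame p) *m X) mu 0 *: Gam R sg mu.

Definition hodge (R : realType) (sg : signature) (M : surface R)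
    (g : metric sg M) (P : spin_structure g) (p : P) (X : 'cV[R]_2)
    : 'cV[R]_2 :=
  frame p *m (hodge_mx R sg *m (invmx (frame p) *m X)).

(* The lowered components A_(mu nu) = g(e_mu, A e_nu) of an endomorphism A of
   T_(proj p) M in the frame of p *)
Definition lowered (R : realType) (sg : signature) (M : surface R)
    (g : metric sg M) (P : spin_structure g) (p : P)
    (A : 'cV[R]_2 -> 'cV[R]_2) : 'M[R]_2 :=
  \matrix_(mu, nu) gdot g (proj p) (col mu (frame p)) (A (col nu (frame p))).

(* The matrix g(e_mu, nabla_v e_nu) of the Levi-Civita connection in the local
   frame of the section t *)
Definition conn_form (R : realType) (sg : signature) (M : surface R)
    (g : metric sg M) (P : spin_structure g) (t : triv P) (m : M)
    (v : 'cV[R]_2) : 'M[R]_2 :=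
  \matrix_(mu, nu) gdot g m (col mu (frame (sec t m)))
    (nabla_vf g m v (fun m' => col nu (frame (sec t m')))).

(* The value of nabla_v psi at the point [sec t m] of P, for v in T_m M *)
Definition nabla_spinor (R : realType) (sg : signature) (M : surface R)
    (g : metric sg M) (P : spin_structure g) (t : triv P) (m : M)
    (v : 'cV[R]_2) (psi : P -> 'cV[R]_2) : 'cV[R]_2 :=
  \col_k dir m v (fun m' => psi (sec t m') k 0)
  + so_act sg (conn_form t m v) *m psi (sec t m).

(* kappa(e, e') in T_(proj p) M: the vector with
   g(kappa(e, e'), X) = <e, X . e'> for all X *)
Definition kappa (R : realType) (sg : signature) (vs : symmetry)
    (M : surface R) (g : metric sg M) (P : spin_structure g) (p : P)
    (e e' : 'cV[R]_2) : 'cV[R]_2 :=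
  invmx (g (proj p)) *m \col_k B sg vs e (cliff p (ebase R k) *m e').

(* The vector field kappa_psi; by equivariance the point of P over m at which
   it is evaluated does not matter. *)
Definition kappa_vf (R : realType) (sg : signature) (vs : symmetry)
    (M : surface R) (g : metric sg M) (P : spin_structure g)
    (psi : P -> 'cV[R]_2) (m : M) : 'cV[R]_2 :=
  let p := sec (triv_at P m) m in kappa vs p (psi p) (psi p).

(** ** Admissible connections *)

(* An End(S)-valued one-form: [beta p X] is the endomorphism beta(X), for X in
   T_(proj p) M, written in the identification of the fibre with S given by p.
   Smoothness is that of beta(d/dx^k) for each chart and local section. *)
Definition endo_form (R : realType) (sg : signature) (M : surface R)
    (g : metric sg M) (P : spin_structure g)
    (beta : P -> 'cV[R]_2 -> 'M[R]_2) :=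
  [/\ forall p c X Y, beta p (c *: X + Y) = c *: beta p X + beta p Y,
      forall p s X, Spin sg s ->
        beta (act p s) X = invmx s *m beta p X *m s
    & forall (t : triv P) (a : atlas M) (k i j : 'I_2),
        smooth_on (tdom t `&` dom a) (fun m =>
          beta (sec t m) (jac a (chart_at m) m *m ebase R k) i j)].

(* D = nabla - beta *)
Definition conn_D (R : realType) (sg : signature) (M : surface R)
    (g : metric sg M) (P : spin_structure g)
    (beta : P -> 'cV[R]_2 -> 'M[R]_2) (t : triv P) (m : M) (v : 'cV[R]_2)
    (psi : P -> 'cV[R]_2) : 'cV[R]_2 :=
  nabla_spinor t m v psi - beta (sec t m) v *m psi (sec t m).

Definition parallel (R : realType) (sg : signature) (M : surface R)
    (g : metric sg M) (P : spin_structure g)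
    (beta : P -> 'cV[R]_2 -> 'M[R]_2) (psi : P -> 'cV[R]_2) :=
  spinor_field psi /\
  forall (t : triv P) m v, tdom t m -> conn_D beta t m v psi = 0.

(* gamma(e, e) X, for X in T_(proj p) M *)
Definition gamma (R : realType) (sg : signature) (vs : symmetry)
    (M : surface R) (g : metric sg M) (P : spin_structure g)
    (beta : P -> 'cV[R]_2 -> 'M[R]_2) (p : P) (e X : 'cV[R]_2) : 'cV[R]_2 :=
  - 2 *: kappa vs p e (beta p X *m e).

(* L_X psi at the point [sec t m] *)
Definition lie_spinor (R : realType) (sg : signature) (M : surface R)
    (g : metric sg M) (P : spin_structure g) (X : M -> 'cV[R]_2) (t : triv P)
    (m : M) (psi : P -> 'cV[R]_2) : 'cV[R]_2 :=
  nabla_spinor t m (X m) psi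
  - so_act sg (lowered (sec t m) (fun v => nabla_vf g m v X)) *m psi (sec t m).

(* (L_X beta)(Y) psi at the point [sec t m] *)
Definition lie_form (R : realType) (sg : signature) (M : surface R)
    (g : metric sg M) (P : spin_structure g) (X : M -> 'cV[R]_2)
    (beta : P -> 'cV[R]_2 -> 'M[R]_2) (Y : M -> 'cV[R]_2) (t : triv P)
    (m : M) (psi : P -> 'cV[R]_2) : 'cV[R]_2 :=
  lie_spinor X t m (fun p => beta p (Y (proj p)) *m psi p)
  - beta (sec t m) (bracket X Y m) *m psi (sec t m)
  - beta (sec t m) (Y m) *m lie_spinor X t m psi.

Definition admissible (R : realType) (sg : signature) (vs : symmetry)
    (M : surface R) (g : metric sg M) (P : spin_structure g)
    (beta : P -> 'cV[R]_2 -> 'M[R]_2) :=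
  [/\ endo_form beta,
      forall (psi : P -> 'cV[R]_2) p (X Y : 'cV[R]_2), spinor_field psi ->
        gdot g (proj p) (gamma vs beta p (psi p) X) Y
        = - gdot g (proj p) X (gamma vs beta p (psi p) Y),
      forall (psi : P -> 'cV[R]_2) p, spinor_field psi ->
        beta p (kappa vs p (psi p) (psi p)) *m psi p
        + so_act sg (lowered p (gamma vs beta p (psi p))) *m psi p = 0
    & forall psi : P -> 'cV[R]_2, parallel beta psi ->
        forall (Y : M -> 'cV[R]_2) (phi : P -> 'cV[R]_2) (t : triv P) m,
        smooth_vf setT Y -> spinor_field phi -> tdom t m ->
        lie_form (kappa_vf vs psi) beta Y t m phi = 0].

Definition beta_b (R : realType) (sg : signature) (vs : symmetry)
    (M : surface R) (g : metric sg M) (P : spin_structure g) (b : M -> R)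
    (p : P) (X : 'cV[R]_2) : 'M[R]_2 :=
  match vs with
  | Skew => b (proj p) *: cliff p X
  | Symmetric => b (proj p) *: cliff p (hodge p X)
  end.

(* Main.v *)
From mathcomp Require Import all_boot all_order all_algebra ring lra.
From mathcomp Require Import all_classical all_reals all_analysis.
(* after all_classical, whose [proj] would otherwise hide the bundle projection *)
Require Import Defs.

(* Let [<-,->'] be the symmetric admissible form, whatever the sign of [B], and
   [beta_1] the form [beta] for [b = 1].  Since [<-,->'] is parallel, [D psi = 0]
   gives [X <psi, psi>' = 2 b <psi, beta_1(X) psi>'], and in each of the four cases
   [X |-> <psi, beta_1(X) psi>'] is, up to sign, the Hodge dual of [kappa].  So
   [d d <psi, psi>' = 0] reads [db wedge star kappa + b d (star kappa) = 0].  The second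
   term vanishes because [nabla] is torsion-free and [<psi, beta_1(X) beta_1(Y) psi>']
   is symmetric in [X, Y]; hence [kappa b = 0], without any use of curvature.
   On the other hand [nabla kappa] is skew, so that [L_kappa] commutes with
   Clifford multiplication and with the Hodge star, and
   [L_kappa beta = (kappa b) beta_1 = 0].  The first two conditions are identities
   between 2x2 matrices in an orthonormal frame. *)

Set Implicit Arguments.
Unset Strict Implicit.
Unset Printing Implicit Defensive.

Import Order.TTheory GRing.Theory Num.Theory.
Import numFieldNormedType.Exports.

Local Open Scope classical_set_scope.
Local Open Scope ring_scope.

(** * Differentiation of matrix-valued functions *)

(** The symmetric form is used even when [B] is skew because [B psi psi] would then vanish
    identically. In dimension two, [db wedge star kappa] is [db(kappa)] times the area form, which
    is why one scalar identity is enough; it is obtained without dividing by [b], so zeros of [b]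
    need no separate case. The representation of tensors shapes the proof. A tangent vector at [m]
    is written in the preferred chart of [m], which may change arbitrarily from point to point, so
    the values of a vector field or of a frame cannot be differentiated directly. Whatever is
    differentiated is moved to a fixed chart ([tcoord], [gcoord], [frame_coord], [coframe]); at the
    point [m] itself, in [chart_at m], the Jacobian is the identity and the original values return.
    Comparing mixed second derivatives moreover requires the first derivatives at all points of a
    neighbourhood in one common chart, although [nabla_spinor] only refers to the preferred chart of
    each point; hence the change-of-chart lemmas. *)

Lemma is_derive_mxP (R : realFieldType) (V : normedModType R) m n
    (F : V -> 'M[R]_(m, n)) (x v : V) (dF : 'M[R]_(m, n)) :
  is_derive x v F dF <-> forall i j, is_derive x v (fun y => F y i j) (dF i j).
Proof.
split=> [[Fd <-] i j|Fij].
  apply: DeriveDef; first by move/derivable_mxP : Fd; apply.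
  by rewrite derive_mx// mxE.
have Fd : derivable F x v by apply/derivable_mxP => i j; apply: ex_derive.
apply: DeriveDef => //; rewrite derive_mx//.
by apply/matrixP => i j; rewrite mxE; apply: derive_val.
Qed.

Lemma is_derive_big_sum (R : numFieldType) (V W : normedModType R) n
    (h : 'I_n -> V -> W) (x v : V) (dh : 'I_n -> W) :
  (forall i, is_derive x v (h i) (dh i)) ->
  is_derive x v (fun y => \sum_i h i y) (\sum_i dh i).
Proof.
move=> hd; have := @is_derive_sum R V W n h x v dh hd.
by congr (is_derive _ _ _ _); apply/funext => y; rewrite fct_sumE.
Qed.

Section matrix_derivatives.
Context {R : realFieldType} {V : normedModType R}.
Implicit Types x v : V.

Lemma is_derive_mulmx m n p (F : V -> 'M[R]_(m, n)) (G : V -> 'M[R]_(n, p))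
    x v dF dG :
  is_derive x v F dF -> is_derive x v G dG ->
  is_derive x v (fun y => F y *m G y) (dF *m G x + F x *m dG).
Proof.
move=> /is_derive_mxP dFij /is_derive_mxP dGij; apply/is_derive_mxP => i j.
have -> : (fun y => (F y *m G y) i j) = (fun y => \sum_k F y i k * G y k j).
  by apply/funext => y; rewrite mxE.
rewrite !mxE -big_split/=; apply: is_derive_big_sum => k.
apply: is_derive_eq (is_deriveM (dFij i k) (dGij k j)) _.
by rewrite /GRing.scale/= addrC [G x k j * _]mulrC.
Qed.

Lemma is_derive_trmx m n (F : V -> 'M[R]_(m, n)) x v dF :
  is_derive x v F dF -> is_derive x v (fun y => (F y)^T) dF^T.
Proof.
move=> /is_derive_mxP dFij; apply/is_derive_mxP => i j.
rewrite mxE; suff -> : (fun y => (F y)^T i j) = (fun y => F y j i) by [].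
by apply/funext => y; rewrite mxE.
Qed.

Lemma is_derive_scalemx m n (b : V -> R) (F : V -> 'M[R]_(m, n)) x v db dF :
  is_derive x v b db -> is_derive x v F dF ->
  is_derive x v (fun y => b y *: F y) (db *: F x + b x *: dF).
Proof.
move=> dbx /is_derive_mxP dFij; apply/is_derive_mxP => i j.
have -> : (fun y => (b y *: F y) i j) = b * (fun y => F y i j).
  by apply/funext => y; rewrite mxE.
apply: is_derive_eq (is_deriveM dbx (dFij i j)) _.
by rewrite /GRing.scale/= !mxE addrC [F x i j * _]mulrC.
Qed.

End matrix_derivatives.

Section differentiation_in_coordinates.
Context {R : realType}.
Implicit Types (U : normedModType R).

Lemma differentiable_col U n (F : U -> 'cV[R]_n) x :
  (forall i, differentiable (fun y => F y i 0) x) -> differentiable F x.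
Proof.
move=> Fi.
have -> : F = \sum_i (fun y => F y i 0 *: (delta_mx i 0 : 'cV[R]_n)).
  apply/funext => y; rewrite fct_sumE {1}[F y]matrix_sum_delta.
  by apply: eq_bigr => i _; rewrite big_ord1.
by apply: differentiable_sum => i; exact: differentiableZl.
Qed.

Lemma col_sum_ebase (v : 'cV[R]_2) : v = \sum_k v k 0 *: ebase R k.
Proof. by rewrite {1}[v]matrix_sum_delta; apply: eq_bigr => i _; rewrite big_ord1. Qed.

Lemma derive_ebase (f : 'cV[R]_2 -> R) x v : differentiable f x ->
  'D_v f x = \sum_k v k 0 * 'D_(ebase R k) f x.
Proof.
move=> fx; rewrite deriveE// {1}(col_sum_ebase v) linear_sum.
by apply: eq_bigr => k _; rewrite linearZ/= deriveE.
Qed.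

Lemma derive_comp (f : 'cV[R]_2 -> R) (F : 'cV[R]_2 -> 'cV[R]_2) x v :
  (forall i, differentiable (fun y => F y i 0) x) ->
  differentiable f (F x) ->
  'D_v (f \o F) x =
  'D_((\matrix_(i, k) 'D_(ebase R k) (fun y => F y i 0) x) *m v) f (F x).
Proof.
move=> Fi fF; have Fx := differentiable_col Fi.
rewrite deriveE; last exact: differentiable_comp.
rewrite diff_comp//= -!deriveE//; congr ('D_ _ f (F x)).
rewrite derive_mx; last exact: diff_derivable.
apply/matrixP => i j; rewrite ord1 !mxE derive_ebase//.
by apply: eq_bigr => k _; rewrite mxE mulrC.
Qed.

End differentiation_in_coordinates.

(** * Equality of mixed second derivatives *)

Section second_derivatives.
Context {R : realType} {V : normedModType R}.
Implicit Types (f : V -> R) (u v x : V).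

Lemma is_derive_line f x v (t : R) : derivable f (t *: v + x) v ->
  is_derive t 1 (fun s => f (s *: v + x)) ('D_v f (t *: v + x)).
Proof.
have E : (fun h : R => h^-1 *: (f ((h *: (1 : R) + t) *: v + x) - f (t *: v + x)))
     = (fun h : R => h^-1 *: (f (h *: v + (t *: v + x)) - f (t *: v + x))).
  by apply/funext => h; rewrite scalerDl -addrA /GRing.scale/= mulr1.
move=> fd; apply: DeriveDef; first by rewrite /derivable E.
by rewrite /derive E.
Qed.

Lemma MVT_line f x v (h : R) : 0 < h ->
  (forall t, 0 <= t <= h -> derivable f (t *: v + x) v) ->
  exists2 t, 0 <= t <= h & f (h *: v + x) - f x = 'D_v f (t *: v + x) * h.
Proof.
move=> h0 fd.
have [|| t th E] := @MVT_segment R (fun s => f (s *: v + x))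
  (fun t => 'D_v f (t *: v + x)) 0 h (ltW h0).
- move=> t; rewrite in_itv/= => /andP[t0 th].
  by apply: is_derive_line; apply: fd; rewrite !ltW.
- apply: derivable_within_continuous => t; rewrite in_itv/= => th.
  by apply: ex_derive; apply: is_derive_line; exact: fd.
- exists t; first by move: th; rewrite in_itv.
  by move: E; rewrite scale0r add0r subr0.
Qed.

(** The mean value theorem is applied twice: along [u] to the increment of [f] by [h *: v], then
    along [v] to ['D_u f]. *)
Lemma second_difference f x u v (h : R) : 0 < h ->
  (forall s t, 0 <= s <= h -> 0 <= t <= h ->
    derivable f (s *: u + (t *: v + x)) u
    /\ derivable ('D_u f) (s *: u + (t *: v + x)) v) ->
  exists s t, [/\ 0 <= s <= h, 0 <= t <= h &
    f (h *: u + (h *: v + x)) - f (h *: v + x) - (f (h *: u + x) - f x) =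
    'D_v ('D_u f) (s *: u + (t *: v + x)) * h * h].
Proof.
move=> h0 fd; have hh : 0 <= h <= h by apply/andP; split => //; exact: ltW.
have oh : 0 <= (0 : R) <= h by apply/andP; split => //; exact: ltW.
pose F y := f (h *: v + y) - f y.
have dF y : derivable f (h *: v + y) u -> derivable f y u ->
    is_derive y u F ('D_u f (h *: v + y) - 'D_u f y).
  move=> d1 d2; apply: is_deriveB; last exact: derivableP.
  have E : (fun r : R => r^-1 *: (f (h *: v + (r *: u + y)) - f (h *: v + y)))
      = (fun r : R => r^-1 *: (f (r *: u + (h *: v + y)) - f (h *: v + y))).
    by apply/funext => r; rewrite addrCA.
  by apply: DeriveDef; rewrite /derivable /derive E.
have dFs s : 0 <= s <= h -> is_derive (s *: u + x) u F
    ('D_u f (h *: v + (s *: u + x)) - 'D_u f (s *: u + x)).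
  move=> sh; apply: dF; first by rewrite addrCA; have [] := fd s h sh hh.
  by have [] := fd s 0 sh oh; rewrite scale0r add0r.
have [s sh] := @MVT_line F x u h h0 (fun s sh => @ex_derive _ _ _ _ _ _ _ (dFs s sh)).
rewrite (@derive_val _ _ _ _ _ _ _ (dFs s sh)) => Es.
have [|t th Et] := @MVT_line ('D_u f) (s *: u + x) v h h0.
  by move=> t th; rewrite addrCA; have [] := fd s t sh th.
exists s, t; split=> //.
by move: Es; rewrite /F Et !(addrCA (_ *: v) (_ *: u)) => <-; ring.
Qed.

Lemma near_parallelogram x u v (P : V -> Prop) : (\near x, P x) ->
  exists2 h : R, 0 < h & forall s t, 0 <= s <= h -> 0 <= t <= h ->
    P (s *: u + (t *: v + x)).
Proof.
move=> /nbhs_ballP[r /= r0 xP].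
have k0 : 0 < 1 + `|u| + `|v| by rewrite -addrA ltr_pwDl// addr_ge0.
(* The displacement has norm at most [h * (|u| + |v|)], which is less than [r]; the summand 1 keeps
   the denominator positive when [u = v = 0]. *)
exists (r / (1 + `|u| + `|v|)); first exact: divr_gt0.
move=> s t /andP[s0 sh] /andP[t0 th]; apply: xP.
rewrite -ball_normE/= distrC addrA addrK.
rewrite (le_lt_trans (ler_normD _ _))// !normrZ !ger0_norm//.
apply: (@le_lt_trans _ _ (r / (1 + `|u| + `|v|) * (`|u| + `|v|))).
  by rewrite mulrDr lerD// ler_wpM2r.
rewrite mulrAC ltr_pdivrMr// ltr_pM2l// -addrA ltr_pwDl//.
Qed.

(** The second difference of [f] is symmetric in [u] and [v]. By [second_difference] the two
    iterated derivatives therefore take a common value, each at some point of an arbitrarily small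
    parallelogram, and continuity at [x] brings both points back to [x]. *)
Lemma derive_comm f x u v :
  (\near x, [/\ derivable f x u, derivable f x v,
    derivable ('D_u f) x v & derivable ('D_v f) x u]) ->
  {for x, continuous ('D_v ('D_u f))} -> {for x, continuous ('D_u ('D_v f))} ->
  'D_v ('D_u f) x = 'D_u ('D_v f) x.
Proof.
move=> fd cvu cuv; apply/eqP; rewrite -subr_eq0 -normr_le0; apply/ler_addgt0Pr.
move=> e e0; rewrite add0r.
have e2 : 0 < e / 2 by rewrite divr_gt0.
move/cvgrPdist_lt : cvu => /(_ _ e2) nvu.
move/cvgrPdist_lt : cuv => /(_ _ e2) nuv.
have [h h0 H] := near_parallelogram u v (filterI fd (filterI nvu nuv)).
have [|s [t [sh th E1]]] := @second_difference f x u v h h0.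
  by move=> s t sh th; have [[? ? ? ?] _] := H s t sh th.
have [|t' [s' [th' sh' E2]]] := @second_difference f x v u h h0.
  move=> s' t' sh' th'; have := H t' s' th' sh'.
  by rewrite (addrCA (t' *: u)) => -[[? ? ? ?] _].
have E : 'D_v ('D_u f) (s *: u + (t *: v + x)) =
         'D_u ('D_v f) (t' *: v + (s' *: u + x)).
  have hn0 : h != 0 by rewrite gt_eqF.
  apply: (mulIf hn0); apply: (mulIf hn0).
  by apply: etrans (esym E1) (etrans _ E2); rewrite (addrCA (h *: v)); ring.
have [_ [/ltW a1 _]] := H s t sh th.
have [_ [_ /ltW a2]] := H s' t' sh' th'.
rewrite [s' *: u + _]addrCA -E in a2.
rewrite (splitr e).
apply: le_trans (ler_distD ('D_v ('D_u f) (s *: u + (t *: v + x))) _ _) _.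
by apply: lerD a1 _; rewrite distrC.
Qed.

End second_derivatives.

(** * Smooth functions on a surface *)

Lemma near_eq_differentiable (R : numFieldType) (V W : normedModType R)
    (f g : V -> W) (x : V) :
  (\near x, f x = g x) -> differentiable f x -> differentiable g x.
Proof.
move=> fg fx.
(* The differential of [f] also approximates [g] to first order; uniqueness of the differential then
   identifies it with that of [g]. *)
have gE : g \o shift x = cst (g x) + 'd f x +o_ 0 id.
  apply/eqaddoP => e e0; have /eqaddoP/(_ e e0) H := diff_locally fx.
  have fg0 : \forall h \near 0, f (h + x) = g (h + x).
    by move: fg; rewrite (near_shift 0 x)/=; apply: filterS => h; rewrite subr0.
  apply: filterS2 fg0 H => h E; rewrite /= !fctE/= E.
  by rewrite (nbhs_singleton fg).
apply/diff_locallyP; rewrite (diff_unique _ gE).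
  by split=> //; exact: diff_continuous.
exact: diff_continuous.
Qed.

Section Ck.
Context {R : realType}.
Implicit Types (O : set 'cV[R]_2) (f g : 'cV[R]_2 -> R) (n : nat).

Lemma open_near (T : topologicalType) (O : set T) (x : T) : open O -> O x ->
  \near x, O x.
Proof. by move=> Oo Ox; apply: open_nbhs_nbhs. Qed.

Lemma Ck_sub n O O' f : O' `<=` O -> Ck n O f -> Ck n O' f.
Proof.
move=> OO'; elim: n f => [f fO x /OO'|n IH f [fO fn]]; first exact: fO.
by split=> [x /OO'|k]; [exact: fO|apply: IH; exact: fn].
Qed.

Lemma CkS n O f : Ck n.+1 O f -> Ck n O f.
Proof.
elim: n f => [f [fO _] x /fO|n IH f [fO fn]].
  exact: differentiable_continuous.
by split=> // k; apply: IH.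
Qed.

Lemma Ck_eq n O f g : open O -> (forall x, O x -> f x = g x) ->
  Ck n O f -> Ck n O g.
Proof.
move=> Oo; have near_eq f' g' x : (forall x, O x -> f' x = g' x) -> O x ->
    \near x, f' x = g' x.
  by move=> fg Ox; apply: filterS (open_near Oo Ox).
elim: n f g => [f g fg fO x Ox|n IH f g fg [fO fn]].
  suff E : g y @[y --> x] --> f x by move: E; rewrite fg.
  apply: cvg_trans (near_eq_cvg (near_eq _ _ _ fg Ox)) _.
  exact: fO.
split=> [x Ox|k]; first by apply: (near_eq_differentiable (near_eq _ _ _ fg Ox)); exact: fO.
by apply: IH (fn k) => x Ox; apply: near_eq_derive; exact: near_eq.
Qed.

Lemma Ck_cst n O (c : R) : Ck n O (cst c).
Proof.
elim: n c => [c x _|n IH c]; first exact: cst_continuous.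
split=> [x _|k]; first exact: differentiable_cst.
have -> : 'D_(ebase R k) (cst c) = cst 0 :> ('cV[R]_2 -> R); last exact: IH.
by apply/funext => x; rewrite derive_cst.
Qed.

Lemma CkD n O f g : open O -> Ck n O f -> Ck n O g -> Ck n O (f + g).
Proof.
move=> Oo; elim: n f g => [f g fO gO x Ox|n IH f g [fO fn] [gO gn]].
  exact: (cvgD (fO x Ox) (gO x Ox)).
split=> [x Ox|k]; first by apply: differentiableD; [exact: fO|exact: gO].
apply: Ck_eq (IH _ _ (fn k) (gn k)) => // x Ox.
by rewrite deriveD//; apply: diff_derivable; [exact: fO|exact: gO].
Qed.

Lemma CkM n O f g : open O -> Ck n O f -> Ck n O g -> Ck n O (f * g).
Proof.
move=> Oo; elim: n f g => [f g fO gO x Ox|n IH f g fC gC].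
  exact: (cvgM (fO x Ox) (gO x Ox)).
have [[fO fn] [gO gn]] := (fC, gC).
split=> [x Ox|k]; first by apply: differentiableM; [exact: fO|exact: gO].
apply: Ck_eq (CkD Oo (IH _ _ (CkS fC) (gn k)) (IH _ _ (CkS gC) (fn k))) => // x Ox.
by rewrite deriveM//; apply: diff_derivable; [exact: fO|exact: gO].
Qed.

Lemma Ck2_comm O f x k l : open O -> Ck 2 O f -> O x ->
  'D_(ebase R l) ('D_(ebase R k) f) x = 'D_(ebase R k) ('D_(ebase R l) f) x.
Proof.
move=> Oo [f1 f2] Ox; apply: derive_comm.
- apply: filterS (open_near Oo Ox) => y Oy.
  by split; apply: diff_derivable; [exact: f1|exact: f1|case: (f2 k) => + _; exact
    |case: (f2 l) => + _; exact].
- by have [_ /(_ l)] := f2 k; exact.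
- by have [_ /(_ k)] := f2 l; exact.
Qed.

End Ck.

Section smooth_functions.
Context {R : realType} {M : surface R}.
Implicit Types (W : set M) (a : atlas M) (m : M).

(** On its image a chart is inverted by [param a], so the set is the part of the open image of the
    chart whose points [param a] sends into [W]. *)
Lemma open_chart_image a W : open W -> open (chart a @` (dom a `&` W)).
Proof.
move=> Wo; have -> : chart a @` (dom a `&` W)
    = (chart a @` dom a) `&` (param a @^-1` W).
  apply/seteqP; split=> [_ [m [am Wm] <-]|x [[m am <-]]].
    by split; [exists m|rewrite /= chartK].
  by rewrite /= chartK// => Wm; exists m.
rewrite openE => x [ax Wx]; have ao := open_near (@image_open _ M a) ax.
have po : nbhs x (param a @^-1` W).
  by apply: (param_continuous ax); exact: open_near.
exact: (filterI ao po).
Qed.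

Lemma near_chart a m W : open W -> dom a m -> W m ->
  \forall x \near chart a m, (chart a @` (dom a `&` W)) x.
Proof.
by move=> Wo am Wm; apply: (open_near (open_chart_image Wo)); exists m.
Qed.

Lemma smooth_on_sub W W' (f : M -> R) : W' `<=` W -> smooth_on W f -> smooth_on W' f.
Proof.
move=> WW' fW a n; apply: Ck_sub (fW a n) => _ [m [am W'm] <-].
by exists m => //; split=> //; exact: WW'.
Qed.

Lemma smooth_on_eq W (f g : M -> R) : open W -> (forall m, W m -> f m = g m) ->
  smooth_on W f -> smooth_on W g.
Proof.
move=> Wo fg fW a n; apply: Ck_eq (fW a n); first exact: open_chart_image.
by move=> _ [m [am Wm] <-]/=; rewrite chartK// fg.
Qed.

Lemma smooth_on_cst W (c : R) : smooth_on W (cst c).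
Proof. by move=> a n; apply: Ck_cst. Qed.

Lemma smooth_onD W (f g : M -> R) : open W -> smooth_on W f -> smooth_on W g ->
  smooth_on W (fun m => f m + g m).
Proof. by move=> Wo fW gW a n; apply: CkD (fW a n) (gW a n); exact: open_chart_image. Qed.

Lemma smooth_onM W (f g : M -> R) : open W -> smooth_on W f -> smooth_on W g ->
  smooth_on W (fun m => f m * g m).
Proof. by move=> Wo fW gW a n; apply: CkM (fW a n) (gW a n); exact: open_chart_image. Qed.

Lemma smooth_on_sum W n (f : 'I_n -> M -> R) : open W ->
  (forall i, smooth_on W (f i)) -> smooth_on W (fun m => \sum_i f i m).
Proof.
move=> Wo; elim: n f => [|n IH] f fW.
  by apply: smooth_on_eq (smooth_on_cst W 0) => // m _; rewrite big_ord0.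
have := smooth_onD Wo (fW ord0) (IH (fun i => f (lift ord0 i)) (fun i => fW _)).
by apply: smooth_on_eq => // m _; rewrite big_ord_recl.
Qed.

Lemma smooth_on_differentiable W (f : M -> R) a m : smooth_on W f ->
  dom a m -> W m -> differentiable (f \o param a) (chart a m).
Proof. by move=> fW am Wm; have [+ _] := fW a 1; apply; exists m. Qed.

Definition smooth_mx W p q (F : M -> 'M[R]_(p, q)) :=
  forall i j, smooth_on W (fun m => F m i j).

Lemma smooth_mx_mul W p q r (F : M -> 'M[R]_(p, q)) (G : M -> 'M[R]_(q, r)) :
  open W -> smooth_mx W F -> smooth_mx W G -> smooth_mx W (fun m => F m *m G m).
Proof.
move=> Wo FW GW i j.
have := smooth_on_sum Wo (fun k => smooth_onM Wo (FW i k) (GW k j)).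
by apply: smooth_on_eq => // m _; rewrite mxE.
Qed.

Lemma smooth_mx_tr W p q (F : M -> 'M[R]_(p, q)) :
  open W -> smooth_mx W F -> smooth_mx W (fun m => (F m)^T).
Proof. by move=> Wo FW i j; apply: smooth_on_eq (FW j i) => // m _; rewrite mxE. Qed.

Lemma smooth_mx_cst W p q (A : 'M[R]_(p, q)) : smooth_mx W (cst A).
Proof. by move=> i j; exact: smooth_on_cst. Qed.

Lemma smooth_mx_scale W p q (f : M -> R) (F : M -> 'M[R]_(p, q)) :
  open W -> smooth_on W f -> smooth_mx W F -> smooth_mx W (fun m => f m *: F m).
Proof.
move=> Wo fW FW i j.
by apply: smooth_on_eq (smooth_onM Wo fW (FW i j)) => // m _; rewrite mxE.
Qed.

Lemma smooth_mx_derivable W p q (F : M -> 'M[R]_(p, q)) a m v :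
  smooth_mx W F -> dom a m -> W m ->
  derivable (F \o param a) (chart a m) v.
Proof.
move=> FW am Wm; apply/derivable_mxP => i j; apply: diff_derivable.
exact: smooth_on_differentiable (FW i j) am Wm.
Qed.

End smooth_functions.

(** * Change of charts *)

Section change_of_charts.
Context {R : realType} {M : surface R}.
Implicit Types (a c : atlas M) (m : M).

Lemma derive_change_chart a c m v (f : M -> R) : dom a m -> dom c m ->
  differentiable (f \o param a) (chart a m) ->
  'D_v (f \o param c) (chart c m) = 'D_(jac c a m *m v) (f \o param a) (chart a m).
Proof.
move=> am cm fa.
have E : chart a (param c (chart c m)) = chart a m by rewrite chartK.
have -> : 'D_v (f \o param c) (chart c m) =
          'D_v ((f \o param a) \o (chart a \o param c)) (chart c m).
  apply: near_eq_derive.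
  apply: filterS (near_chart (@dom_open _ M a) cm am) => _ [m' [cm' am'] <-] /=.
  by rewrite !chartK.
rewrite derive_comp//=; last by rewrite E.
  by rewrite E.
move=> i; have [+ _] := @transition_smooth _ M c a i 1; apply.
by exists m.
Qed.

Lemma smooth_chart a i : smooth_on (dom a) (fun m => chart a m i 0).
Proof. by move=> c; exact: transition_smooth. Qed.

(** The change-of-chart formula is applied to the coordinate functions of [c]: read in the chart [c]
    itself, the derivative of the [i]-th one along [v] is [v i 0]. *)
Lemma jac_cancel a c m : dom a m -> dom c m -> jac a c m *m jac c a m = 1%:M.
Proof.
move=> am cm; suff key (v : 'cV[R]_2) : jac a c m *m (jac c a m *m v) = v.
  apply/matrixP => i j; move: (congr1 (fun A : 'cV[R]_2 => A i 0) (key (delta_mx j 0))).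
  by rewrite mulmxA -colE !mxE eqxx andbT.
apply/matrixP => i j; rewrite ord1.
have fa : differentiable ((fun m => chart c m i 0) \o param a) (chart a m).
  exact: smooth_on_differentiable (smooth_chart c i) am cm.
have := derive_change_chart v am cm fa; rewrite [RHS]derive_ebase//.
have -> : 'D_v ((fun m => chart c m i 0) \o param c) (chart c m) = v i 0.
  have /is_derive_mxP/(_ i 0)[_ <-] := is_derive_id (chart c m) v.
  apply: near_eq_derive.
  apply: filterS (near_chart (@openT M) cm I) => _ [m' [cm' _] <-] /=.
  by rewrite chartK.
by move=> ->; rewrite !mxE; apply: eq_bigr => k _; rewrite !mxE mulrC.
Qed.

Lemma jac_id a m : dom a m -> jac a a m = 1%:M.
Proof.
move=> am; apply/matrixP => i k; rewrite !mxE.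
have /is_derive_mxP/(_ i 0)[_] := is_derive_id (chart a m) (ebase R k).
rewrite mxE andbT => <-; apply: near_eq_derive.
apply: filterS (near_chart (@openT M) am I) => _ [m' [am' _] <-] /=.
by rewrite chartK.
Qed.

Lemma smooth_mx_is_derive W p q (F : M -> 'M[R]_(p, q)) a m v :
  smooth_mx W F -> dom a m -> W m ->
  is_derive (chart a m) v (F \o param a) ('D_v (F \o param a) (chart a m)).
Proof. by move=> FW am Wm; apply: derivableP; exact: smooth_mx_derivable Wm. Qed.

End change_of_charts.

(** * The Clifford algebra *)

Section two_by_two.
Context {R : realType}.
Implicit Types (A : 'M[R]_2) (w : 'cV[R]_2).

Definition cv2 (x y : R) : 'cV[R]_2 := \col_i if i == 0 then x else y.

Lemma ord2P (P : 'I_2 -> Prop) : P 0 -> P 1 -> forall i, P i.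
Proof.
move=> P0 P1 [[|[|//]] lt_i2].
  by rewrite (_ : Ordinal _ = 0)//; apply: val_inj.
by rewrite (_ : Ordinal _ = 1)//; apply: val_inj.
Qed.

Lemma sum2 (V : nmodType) (F : 'I_2 -> V) : \sum_i F i = F 0 + F 1.
Proof. by rewrite !big_ord_recl big_ord0 addr0; congr (_ + F _); apply: val_inj. Qed.

Lemma mx22_eta A : A = mx22 (A 0 0) (A 0 1) (A 1 0) (A 1 1).
Proof. by apply/matrixP; apply: ord2P; apply: ord2P; rewrite mxE. Qed.

Lemma cv2_eta w : w = cv2 (w 0 0) (w 1 0).
Proof. by apply/matrixP => i j; rewrite ord1 mxE; move: i; apply: ord2P. Qed.

Lemma mx22_mul a b c d a' b' c' d' : mx22 a b c d *m mx22 a' b' c' d' =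
  mx22 (a * a' + b * c') (a * b' + b * d') (c * a' + d * c') (c * b' + d * d') :> 'M[R]_2.
Proof. by apply/matrixP; apply: ord2P; apply: ord2P; rewrite !mxE sum2 !mxE. Qed.

Lemma mx22_mulv a b c d x y :
  mx22 a b c d *m cv2 x y = cv2 (a * x + b * y) (c * x + d * y).
Proof.
by apply/matrixP => i j; rewrite ord1; move: i; apply: ord2P; rewrite !mxE sum2 !mxE.
Qed.

Lemma mx22D a b c d a' b' c' d' : mx22 a b c d + mx22 a' b' c' d' =
  mx22 (a + a') (b + b') (c + c') (d + d') :> 'M[R]_2.
Proof. by apply/matrixP; apply: ord2P; apply: ord2P; rewrite !mxE. Qed.

Lemma mx22N a b c d : - mx22 a b c d = mx22 (- a) (- b) (- c) (- d) :> 'M[R]_2.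
Proof. by apply/matrixP; apply: ord2P; apply: ord2P; rewrite !mxE. Qed.

Lemma mx22Z k a b c d : k *: mx22 a b c d = mx22 (k * a) (k * b) (k * c) (k * d) :> 'M[R]_2.
Proof. by apply/matrixP; apply: ord2P; apply: ord2P; rewrite !mxE. Qed.

Lemma mx22_tr a b c d : (mx22 a b c d)^T = mx22 a c b d :> 'M[R]_2.
Proof. by apply/matrixP; apply: ord2P; apply: ord2P; rewrite !mxE. Qed.

Lemma mx22_trace a b c d : \tr (mx22 a b c d : 'M[R]_2) = a + d.
Proof. by rewrite /mxtrace sum2 !mxE. Qed.

Lemma mx22_scalar k : k%:M = mx22 k 0 0 k :> 'M[R]_2.
Proof. by apply/matrixP; apply: ord2P; apply: ord2P; rewrite !mxE. Qed.

Lemma mx22_0 : 0 = mx22 0 0 0 0 :> 'M[R]_2.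
Proof. by apply/matrixP; apply: ord2P; apply: ord2P; rewrite !mxE. Qed.

Lemma mx22_mk (F : 'I_2 -> 'I_2 -> R) :
  \matrix_(i, j) F i j = mx22 (F 0 0) (F 0 1) (F 1 0) (F 1 1).
Proof. by apply/matrixP; apply: ord2P; apply: ord2P; rewrite !mxE. Qed.

Lemma cv2_mk (F : 'I_2 -> R) : \col_i F i = cv2 (F 0) (F 1).
Proof. by apply/matrixP => i j; rewrite ord1; move: i; apply: ord2P; rewrite !mxE. Qed.

Lemma cv2D x y x' y' : cv2 x y + cv2 x' y' = cv2 (x + x') (y + y').
Proof. by apply/matrixP => i j; rewrite ord1; move: i; apply: ord2P; rewrite !mxE. Qed.

Lemma cv2N x y : - cv2 x y = cv2 (- x) (- y).
Proof. by apply/matrixP => i j; rewrite ord1; move: i; apply: ord2P; rewrite !mxE. Qed.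

Lemma cv2Z k x y : k *: cv2 x y = cv2 (k * x) (k * y).
Proof. by apply/matrixP => i j; rewrite ord1; move: i; apply: ord2P; rewrite !mxE. Qed.

Lemma cv2_0 : 0 = cv2 0 0.
Proof. by apply/matrixP => i j; rewrite ord1; move: i; apply: ord2P; rewrite !mxE. Qed.

Lemma cv2_delta0 : delta_mx 0 0 = cv2 1 0.
Proof. by rewrite [LHS]cv2_eta !mxE. Qed.

Lemma cv2_delta1 : delta_mx 1 0 = cv2 0 1.
Proof. by rewrite [LHS]cv2_eta !mxE. Qed.

Lemma cv2_00 x y : cv2 x y 0 0 = x. Proof. by rewrite mxE. Qed.
Lemma cv2_10 x y : cv2 x y 1 0 = y. Proof. by rewrite mxE. Qed.

Lemma mx22_00 a b c d : mx22 a b c d 0 0 = a :> R. Proof. by rewrite mxE. Qed.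
Lemma mx22_01 a b c d : mx22 a b c d 0 1 = b :> R. Proof. by rewrite mxE. Qed.
Lemma mx22_10 a b c d : mx22 a b c d 1 0 = c :> R. Proof. by rewrite mxE. Qed.
Lemma mx22_11 a b c d : mx22 a b c d 1 1 = d :> R. Proof. by rewrite mxE. Qed.

Lemma mx22_bil a b c d x y x' y' :
  ((cv2 x y)^T *m mx22 a b c d *m cv2 x' y') 0 0
  = x * (a * x' + b * y') + y * (c * x' + d * y') :> R.
Proof. by rewrite -mulmxA mx22_mulv !mxE sum2 !mxE. Qed.

Lemma cv2_dot x y x' y' : ((cv2 x y)^T *m cv2 x' y') 0 0 = x * x' + y * y'.
Proof. by rewrite !mxE sum2 !mxE. Qed.

Lemma eta_mxE sg : eta_mx R sg = mx22 (eta R sg 0) 0 0 (eta R sg 1).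
Proof. by apply/matrixP; apply: ord2P; apply: ord2P; rewrite !mxE. Qed.

Definition mx22E := (mx22_mul, mx22_mulv, mx22D, mx22N, mx22Z, mx22_tr, mx22_trace,
  mx22_scalar, cv2D, cv2N, cv2Z, cv2_00, cv2_10, mx22_bil, cv2_dot,
  mx22_00, mx22_01, mx22_10, mx22_11).

End two_by_two.

Section clifford_algebra.
Context {R : realType}.
Implicit Types (sg : signature) (vs : symmetry) (w e : 'cV[R]_2) (W s : 'M[R]_2).

Definition clmx sg w : 'M[R]_2 := \sum_mu w mu 0 *: Gam R sg mu.

(* The endomorphism [beta_b] at [b = 1], as a function of the components of the
   vector in an orthonormal frame *)
Definition betamx sg vs w : 'M[R]_2 :=
  match vs with Skew => clmx sg w | Symmetric => clmx sg (hodge_mx R sg *m w) end.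

Lemma clmx_linear sg k w w' : clmx sg (k *: w + w') = k *: clmx sg w + clmx sg w'.
Proof.
rewrite /clmx scaler_sumr -big_split/=; apply: eq_bigr => mu _.
by rewrite !mxE scalerDl scalerA.
Qed.

Lemma betamx_linear sg vs k w w' :
  betamx sg vs (k *: w + w') = k *: betamx sg vs w + betamx sg vs w'.
Proof.
by case: vs; rewrite /betamx ?mulmxDr -?scalemxAr clmx_linear.
Qed.

(** In dimension two only [Gamma^(01)] and its opposite occur, and it equals the plain product
    because the two Gamma matrices anticommute. Only the skew part of [W] acts. *)
Lemma so_actE sg W :
  so_act sg W = (4^-1 * (W 0 1 - W 1 0)) *: (Gam_up R sg 0 *m Gam_up R sg 1).
Proof.
rewrite /so_act !sum2 /Gam_up2 !subrr !scaler0 add0r addr0.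
case: sg; rewrite /Gam_up/= /sigma1 /sigma3 /Omega; rewrite !mx22E; by congr mx22; field.
Qed.

(** Reduces an identity to explicit matrices or vectors with polynomial entries; the entries are
    left to [ring], [field] or [lra]. *)
Ltac mx22_solve := rewrite ?so_actE /betamx /clmx ?sum2 /hodge_mx /epsilon /Gam_up /Gam
  /Bmx ?eta_mxE /sigma1 /sigma3 /Omega ?mx22_mk /eta /= ?mx22E.

(** Infinitesimal equivariance of Clifford multiplication: the commutator with [so_act sg W] is the
    action of [W], with its first index raised, on vectors. It extends to the starred case since the
    Hodge star commutes with such endomorphisms. *)
Lemma so_act_betamx sg vs W w : W^T = - W ->
  so_act sg W *m betamx sg vs w - betamx sg vs w *m so_act sg W
  = betamx sg vs (eta_mx R sg *m (W *m w)).
Proof.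
rewrite (mx22_eta W) (cv2_eta w) => /matrixP WT.
have := WT 0 0; have := WT 0 1; have := WT 1 0; have := WT 1 1.
move: (W 0 0) (W 0 1) (W 1 0) (W 1 1) (w 0 0) (w 1 0) => W00 W01 W10 W11 w0 w1.
rewrite mx22_tr mx22N !mxE/= => e11 -> _ e00.
have {e11} -> : W11 = 0 by lra.
have {e00} -> : W00 = 0 by lra.
by case: sg; case: vs; rewrite so_actE; mx22_solve; congr mx22; field.
Qed.

Lemma so_act_Bmx sg vs W :
  (so_act sg W)^T *m Bmx R sg vs + Bmx R sg vs *m so_act sg W = 0.
Proof.
by case: sg; case: vs; mx22_solve; rewrite [RHS]mx22_0; congr mx22; ring.
Qed.

(** For both signs of [B] this is the symmetry of the Dirac current in its two spinors. *)
Lemma Bmx_clmx_sym sg vs w :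
  (Bmx R sg vs *m clmx sg w)^T = Bmx R sg vs *m clmx sg w.
Proof.
by rewrite (cv2_eta w); case: sg; case: vs; mx22_solve; congr mx22; ring.
Qed.

Lemma Bmx_betamx_sym sg vs w :
  (Bmx R sg Symmetric *m betamx sg vs w)^T = Bmx R sg Symmetric *m betamx sg vs w.
Proof. by case: vs; exact: Bmx_clmx_sym. Qed.

Lemma B_mulmx sg vs (A : 'M[R]_2) e e' :
  B sg vs e (A *m e') = (e^T *m (Bmx R sg vs *m A) *m e') 0 0.
Proof. by rewrite /B !mulmxA. Qed.

(* the lowered frame components of kappa(e, e') *)
Definition current sg vs e e' : 'cV[R]_2 := \col_mu B sg vs e (Gam R sg mu *m e').

Lemma B_clmx sg vs w e e' :
  B sg vs e (clmx sg w *m e') = (w^T *m current sg vs e e') 0 0.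
Proof.
rewrite (cv2_eta w) (cv2_eta e) (cv2_eta e').
rewrite /current cv2_mk ?mulmxA !B_mulmx.
by case: sg; case: vs; mx22_solve; ring.
Qed.

(** The core of the first admissibility condition, and the reason for the star when [B] is
    symmetric. The product [w . w'] is a scalar [eta(w, w')] plus a skew term in [Gamma_0 Gamma_1].
    For skew [B] the scalar term dies because [B e e = 0]. For symmetric [B] it is the
    [Gamma_0 Gamma_1] term that dies, by invariance of [B]; the remaining [eta(w, *w')] is skew in
    [w] and [w']. *)
Lemma B_clmx_betamx_skew sg vs w w' e :
  B sg vs e (clmx sg w *m (betamx sg vs w' *m e)) =
  - B sg vs e (clmx sg w' *m (betamx sg vs w *m e)).
Proof.
rewrite (cv2_eta w) (cv2_eta w') (cv2_eta e) ?mulmxA !B_mulmx.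
by case: sg; case: vs; mx22_solve; ring.
Qed.

(* For the symmetric form [C], the one-form [psi^T C beta psi] is the Hodge dual
   of the Dirac current, up to sign. *)
Lemma current_dual sg vs : exists c : R, forall e,
  eta_mx R sg *m current sg vs e e = cv2
   (c * B sg Symmetric e (betamx sg vs (cv2 0 1) *m e))
   (- c * B sg Symmetric e (betamx sg vs (cv2 1 0) *m e)).
Proof.
(* The sign of the duality, by computation; it is [+1] only for Lorentzian signature and skew
   [B]. *)
case: sg; case: vs; [exists (-1)|exists (-1)|exists (-1)|exists 1].
all: move=> e; rewrite (cv2_eta e) /current cv2_mk ?mulmxA !B_mulmx; mx22_solve; congr cv2.
all: by ring.
Qed.

(** Trades a connection term on the spinor for one on the vector. Write [S] for the spin action and
    [M] for [betamx sg vs w]: since [C] is invariant and [C M] symmetric, [C S M] and [C M S] are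
    opposite as quadratic forms, so each accounts for half of the commutator. *)
Lemma B_betamx_so_act sg vs W w e : W^T = - W ->
  2 * B sg Symmetric e (betamx sg vs w *m (so_act sg W *m e))
  = - B sg Symmetric e (betamx sg vs (eta_mx R sg *m (W *m w)) *m e).
Proof.
move=> /so_act_betamx <-; rewrite mulmxA !B_mulmx mulmxBr mulmxBr mulmxBl.
set C := Bmx R sg Symmetric; set M := betamx sg vs w; set S := so_act sg W.
have SC : C *m S = - (S^T *m C).
  by apply/eqP; rewrite -addr_eq0 addrC so_act_Bmx.
have E : (e^T *m (C *m (S *m M)) *m e) 0 0 = - (e^T *m (C *m (M *m S)) *m e) 0 0.
  have T : (C *m (S *m M))^T = - (C *m (M *m S)).
    rewrite mulmxA SC mulNmx linearN/= -mulmxA trmx_mul trmxK.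
    by rewrite Bmx_betamx_sym mulmxA.
  rewrite -[in LHS](trmxK (e^T *m _ *m e)) mxE 2!trmx_mul trmxK T.
  by rewrite mulNmx mulmxN mxE mulmxA.
by rewrite [in RHS]mxE [X in - (_ + X)]mxE E; ring.
Qed.

(** The commutator of two Clifford vectors is a multiple of [Gamma_0 Gamma_1], whose diagonal values
    vanish for an invariant symmetric form. *)
Lemma B_betamx2C sg vs w w' e :
  B sg Symmetric e (betamx sg vs w *m (betamx sg vs w' *m e))
  = B sg Symmetric e (betamx sg vs w' *m (betamx sg vs w *m e)).
Proof.
rewrite (cv2_eta w) (cv2_eta w') (cv2_eta e) ?mulmxA !B_mulmx.
by case: sg; case: vs; mx22_solve; ring.
Qed.

(** Infinitesimal equivariance of the Dirac current; the factor 2 accounts for its two equal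
    arguments. *)
Lemma current_so_act sg vs W e : W^T = - W ->
  2 *: current sg vs e (so_act sg W *m e) = W *m (eta_mx R sg *m current sg vs e e).
Proof.
rewrite (mx22_eta W) (cv2_eta e) => /matrixP WT.
have := WT 0 0; have := WT 0 1; have := WT 1 1.
move: (W 0 0) (W 0 1) (W 1 0) (W 1 1) (e 0 0) (e 1 0) => W00 W01 W10 W11 e0 e1.
rewrite mx22_tr mx22N !mxE/= => e11 e01 e00.
have {e11} -> : W11 = 0 by lra.
have {e00} -> : W00 = 0 by lra.
have {e01} -> : W10 = - W01 by lra.
rewrite /current so_actE !cv2_mk ?mulmxA !B_mulmx.
by case: sg; case: vs; mx22_solve; congr cv2; field.
Qed.

(* the lowered frame components of [nabla kappa] for a parallel spinor, up to the
   factor [2 b] *)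
Definition dcurrent sg vs e : 'M[R]_2 :=
  \matrix_(mu, nu) B sg vs e (Gam R sg mu *m (betamx sg vs (delta_mx nu 0) *m e)).

Lemma dcurrent_mul sg vs e w :
  dcurrent sg vs e *m w = current sg vs e (betamx sg vs w *m e).
Proof.
rewrite (cv2_eta e) (cv2_eta w) /current /dcurrent cv2_mk mx22_mk.
rewrite cv2_delta0 cv2_delta1 ?mulmxA !B_mulmx.
by case: sg; case: vs; mx22_solve; congr cv2; ring.
Qed.

(** A Fierz identity, cubic in the spinor: the second admissibility condition with [b] factored out.
    The coefficient [-2] is the one in [gamma]. *)
Lemma betamx_current sg vs e :
  betamx sg vs (eta_mx R sg *m current sg vs e e) *m e
  - 2 *: (so_act sg (dcurrent sg vs e) *m e) = 0.
Proof.
rewrite (cv2_eta e) /current /dcurrent so_actE cv2_mk mx22_mk mx22_01 mx22_10.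
rewrite cv2_delta0 cv2_delta1 ?mulmxA !B_mulmx.
by case: sg; case: vs; mx22_solve; rewrite [RHS]cv2_0; congr cv2; field.
Qed.

Lemma clmx_delta sg mu : clmx sg (delta_mx mu 0) = Gam R sg mu.
Proof.
by rewrite /clmx sum2; move: mu; apply: ord2P;
  rewrite !mxE/= scale0r scale1r ?addr0 ?add0r.
Qed.

Lemma dcurrent_skew sg vs e : (dcurrent sg vs e)^T = - dcurrent sg vs e.
Proof.
by apply/matrixP => mu nu; rewrite !mxE -!clmx_delta B_clmx_betamx_skew.
Qed.

Lemma eta_mxK sg : eta_mx R sg *m eta_mx R sg = 1%:M.
Proof. by case: sg; mx22_solve; congr mx22; ring. Qed.

Lemma eta_mx_tr sg : (eta_mx R sg)^T = eta_mx R sg.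
Proof. exact: tr_diag_mx. Qed.

(** * Equivariance under the Spin group *)

Section spin.
Variables (sg : signature) (s : 'M[R]_2).
Hypothesis spin_s : Spin sg s.

Lemma spin_unit : s \in unitmx.
Proof. by have [x [y [-> /mulmx1_unit[]]]] := spin_s. Qed.

Lemma spin_explicit : exists x y : R, let w := y *: (Gam R sg 0 *m Gam R sg 1) in
  [/\ s = x%:M + w, invmx s = x%:M - w & (x%:M + w) *m (x%:M - w) = 1%:M].
Proof.
have [x [y [sE E]]] := spin_s; exists x, y; split=> //.
have su := spin_unit.
by rewrite -[RHS](mulKmx su) {3}sE E mulmx1.
Qed.

Lemma Bmx_spin vs : (invmx s)^T *m Bmx R sg vs *m invmx s = Bmx R sg vs.
Proof.
have [x [y [_ -> /matrixP/(_ 0 0)]]] := spin_explicit.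
case: sg; case: vs; mx22_solve => E; congr mx22; first [ring | lra].
Qed.

(** Since [Ad sg s] is orthogonal for [eta], the matrix [eta Ad^T eta] is its inverse; in this form
    it appears when the inverse frame is moved along the fibre of [P]. *)
Lemma clmx_Ad w :
  clmx sg (eta_mx R sg *m (Ad sg s)^T *m eta_mx R sg *m w)
  = invmx s *m clmx sg w *m s.
Proof.
have [x [y [sE Vs _]]] := spin_explicit.
rewrite (cv2_eta w) /Ad Vs sE.
by case: sg; mx22_solve; congr mx22; field.
Qed.

Lemma hodge_mx_Ad :
  hodge_mx R sg *m (eta_mx R sg *m (Ad sg s)^T *m eta_mx R sg)
  = eta_mx R sg *m (Ad sg s)^T *m eta_mx R sg *m hodge_mx R sg.
Proof.
have [x [y [sE Vs _]]] := spin_explicit.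
rewrite /Ad Vs sE.
by case: sg; mx22_solve; congr mx22; field.
Qed.

Lemma betamx_Ad vs w :
  betamx sg vs (eta_mx R sg *m (Ad sg s)^T *m eta_mx R sg *m w)
  = invmx s *m betamx sg vs w *m s.
Proof.
case: vs; last exact: clmx_Ad.
by rewrite /betamx [_ *m (_ *m w)]mulmxA hodge_mx_Ad -mulmxA clmx_Ad.
Qed.

Lemma B_spin vs e e' : B sg vs (invmx s *m e) (invmx s *m e') = B sg vs e e'.
Proof. by rewrite /B trmx_mul -[in RHS](Bmx_spin vs) !mulmxA. Qed.

End spin.

End clifford_algebra.

(** * Orthonormal frames *)

Lemma gram_unit (R : realType) (sg : signature) (M : surface R) (g : metric sg M) m :
  g m \in unitmx.
Proof.
have [E EgE] := gram_signature g m.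
have : (eta_mx R sg *m E^T) *m (g m *m E) = 1%:M.
  by rewrite !mulmxA -(mulmxA _ E^T) -mulmxA EgE eta_mxK.
by case/mulmx1_unit => _; rewrite unitmx_mul => /andP[].
Qed.

Section orthonormal_frames.
Context {R : realType} {sg : signature} {M : surface R} {g : metric sg M}.
Context {P : spin_structure g}.
Implicit Types (p : P) (e X Y : 'cV[R]_2) (vs : symmetry) (b : M -> R) (t : triv P)
  (a : atlas M) (m : M).

Lemma frame_cancel p :
  (eta_mx R sg *m ((frame p)^T *m g (proj p))) *m frame p = 1%:M.
Proof. by rewrite -mulmxA frame_orthonormal eta_mxK. Qed.

Lemma frame_unit p : frame p \in unitmx.
Proof. by have [] := mulmx1_unit (frame_cancel p). Qed.

Lemma frame_inv p :
  invmx (frame p) = eta_mx R sg *m ((frame p)^T *m g (proj p)).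
Proof. by rewrite -[RHS](mulmxK (frame_unit p)) frame_cancel mul1mx. Qed.

Lemma gram_inv p :
  invmx (g (proj p)) = frame p *m (eta_mx R sg *m (frame p)^T).
Proof.
have E : (frame p *m (eta_mx R sg *m (frame p)^T)) *m g (proj p) = 1%:M.
  by rewrite -!mulmxA -frame_inv mulmxV// frame_unit.
have [_ gu] := mulmx1_unit E.
by rewrite -[RHS](mulmxK gu) E mul1mx.
Qed.

Lemma cliffE p X : cliff p X = clmx sg (invmx (frame p) *m X).
Proof. by []. Qed.

Lemma beta_bE vs b p X :
  beta_b vs b p X = b (proj p) *: betamx sg vs (invmx (frame p) *m X).
Proof.
by case: vs => //=; rewrite /hodge cliffE mulKmx// frame_unit.
Qed.

Lemma kappaE vs p e e' :
  kappa vs p e e' = frame p *m (eta_mx R sg *m current sg vs e e').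
Proof.
rewrite /kappa gram_inv.
have -> : \col_k B sg vs e (cliff p (ebase R k) *m e')
    = (invmx (frame p))^T *m current sg vs e e'.
  apply/matrixP => k j; rewrite ord1 mxE cliffE B_clmx /ebase -colE.
  by rewrite tr_col -row_mul mxE.
rewrite -!mulmxA (mulmxA (frame p)^T) -trmx_mul mulVmx ?frame_unit//.
by rewrite trmx1 mul1mx.
Qed.

Lemma gdotC m X Y : gdot g m X Y = gdot g m Y X.
Proof.
rewrite /gdot -[in LHS](trmxK (X^T *m g m *m Y)) mxE.
by rewrite !trmx_mul trmxK gram_sym mulmxA.
Qed.

Lemma gdot_kappa vs p X e e' :
  gdot g (proj p) X (kappa vs p e e')
  = B sg vs e (clmx sg (invmx (frame p) *m X) *m e').
Proof.
rewrite B_clmx kappaE /gdot frame_inv !trmx_mul gram_sym trmxK eta_mx_tr.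
by rewrite !mulmxA.
Qed.

Lemma gdot_gamma vs b p e X Y :
  gdot g (proj p) Y (gamma vs (beta_b vs b) p e X) =
  - 2 * b (proj p) * B sg vs e (clmx sg (invmx (frame p) *m Y) *m
    (betamx sg vs (invmx (frame p) *m X) *m e)).
Proof.
rewrite /gamma /gdot -scalemxAr mxE -/(gdot g (proj p) Y _) gdot_kappa beta_bE.
rewrite -mulrA; congr (_ * _).
by rewrite -scalemxAl -scalemxAr /B -scalemxAr mxE.
Qed.

Lemma gamma_skew vs b p e X Y :
  gdot g (proj p) (gamma vs (beta_b vs b) p e X) Y
  = - gdot g (proj p) X (gamma vs (beta_b vs b) p e Y).
Proof. by rewrite gdotC !gdot_gamma B_clmx_betamx_skew mulrN. Qed.

Lemma frame_inv_col p mu : invmx (frame p) *m col mu (frame p) = delta_mx mu 0.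
Proof. by rewrite colE mulKmx ?frame_unit. Qed.

Lemma so_actZ k (W : 'M[R]_2) : so_act sg (k *: W) = k *: so_act sg W.
Proof. by rewrite !so_actE !mxE scalerA; congr (_ *: _); ring. Qed.

Lemma beta_gamma_cancel vs b p e :
  beta_b vs b p (kappa vs p e e) *m e
  + so_act sg (lowered p (gamma vs (beta_b vs b) p e)) *m e = 0.
Proof.
have -> : lowered p (gamma vs (beta_b vs b) p e) = (- 2 * b (proj p)) *:
    dcurrent sg vs e.
  apply/matrixP => mu nu.
  by rewrite !mxE gdot_gamma !frame_inv_col clmx_delta.
rewrite beta_bE kappaE mulKmx ?frame_unit// so_actZ.
rewrite -[(_ *: betamx _ _ _) *m _]scalemxAl -[(_ *: so_act _ _) *m _]scalemxAl.
rewrite (mulrC (- 2)) -scalerA -scalerDr.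
by rewrite scaleNr betamx_current scaler0.
Qed.

Lemma beta_b_linear vs b p k X Y :
  beta_b vs b p (k *: X + Y) = k *: beta_b vs b p X + beta_b vs b p Y.
Proof.
rewrite !beta_bE mulmxDr -scalemxAr betamx_linear scalerDr.
by rewrite !scalerA mulrC.
Qed.

Lemma frame_inv_act p s X : Spin sg s ->
  invmx (frame (act p s)) *m X
  = eta_mx R sg *m (Ad sg s)^T *m eta_mx R sg *m (invmx (frame p) *m X).
Proof.
move=> ss; rewrite !frame_inv proj_act// frame_act// trmx_mul !mulmxA.
by rewrite -[_ *m eta_mx R sg *m eta_mx R sg]mulmxA eta_mxK mulmx1.
Qed.

Lemma beta_b_act vs b p s X : Spin sg s ->
  beta_b vs b (act p s) X = invmx s *m beta_b vs b p X *m s.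
Proof.
move=> ss; rewrite !beta_bE proj_act// frame_inv_act// betamx_Ad//.
by rewrite -scalemxAr -scalemxAl.
Qed.

Lemma kappa_act vs p s e : Spin sg s ->
  kappa vs (act p s) (invmx s *m e) (invmx s *m e) = kappa vs p e e.
Proof.
move=> ss; rewrite /kappa proj_act//; congr (_ *m _).
apply/matrixP => k j; rewrite !mxE !cliffE frame_inv_act// clmx_Ad//.
have su := spin_unit ss.
by rewrite -!mulmxA (mulKVmx su) B_spin.
Qed.

(** The frame vectors in the coordinates of the one chart [a], where their components are smooth;
    those of [frame (sec t m)] refer to a chart that varies with [m]. *)
Definition frame_coord t a m : 'M[R]_2 := jac (chart_at m) a m *m frame (sec t m).

Lemma smooth_frame t a : smooth_mx (tdom t `&` dom a) (frame_coord t a).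
Proof.
move=> k mu.
have -> : (fun m => frame_coord t a m k mu)
  = (fun m => tcoord a (fun m => col mu (frame (sec t m))) m k 0).
  by apply/funext => m; rewrite !mxE; apply: eq_bigr => l _; rewrite !mxE.
exact: frame_smooth.
Qed.

Lemma frame_coord_gcoord t a m : tdom t m -> dom a m ->
  (frame_coord t a m)^T *m gcoord g a m
  = (frame (sec t m))^T *m g m *m jac a (chart_at m) m.
Proof.
move=> tm am; rewrite /frame_coord /gcoord trmx_mul !mulmxA.
rewrite -[_ *m (jac (chart_at m) a m)^T *m _]mulmxA -trmx_mul.
by rewrite jac_cancel// ?trmx1 ?mulmx1//; exact: dom_chart_at.
Qed.

Lemma frame_coord_orthonormal t a m : tdom t m -> dom a m ->
  (frame_coord t a m)^T *m gcoord g a m *m frame_coord t a m = eta_mx R sg.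
Proof.
move=> tm am; rewrite frame_coord_gcoord// /frame_coord -!mulmxA.
rewrite (mulmxA (jac a _ m)) jac_cancel ?mul1mx//; last exact: dom_chart_at.
by rewrite -(frame_orthonormal (sec t m)) proj_sec// mulmxA.
Qed.

(* The coframe in the coordinates of [a]; expressing the inverse of the frame
   through the metric makes its smoothness evident. *)
Definition coframe t a m : 'M[R]_2 :=
  eta_mx R sg *m ((frame_coord t a m)^T *m gcoord g a m).

Lemma coframeE t a m : tdom t m -> dom a m ->
  coframe t a m = invmx (frame (sec t m)) *m jac a (chart_at m) m.
Proof.
move=> tm am; rewrite /coframe frame_coord_gcoord// frame_inv proj_sec//.
by rewrite !mulmxA.
Qed.

Lemma coframe_cancel t a m : tdom t m -> dom a m ->
  coframe t a m *m frame_coord t a m = 1%:M.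
Proof.
by move=> tm am; rewrite /coframe -mulmxA frame_coord_orthonormal ?eta_mxK.
Qed.

Lemma smooth_gcoord a : smooth_mx (dom a) (gcoord g a).
Proof. by move=> k l; exact: gram_smooth. Qed.

Lemma open_tdom_dom t a : open (tdom t `&` dom a).
Proof. by apply: openI; [exact: tdom_open|exact: dom_open]. Qed.

Lemma smooth_coframe t a : smooth_mx (tdom t `&` dom a) (coframe t a).
Proof.
have Wo := open_tdom_dom t a.
apply: smooth_mx_mul => //; first exact: smooth_mx_cst.
apply: smooth_mx_mul => //; first by apply: smooth_mx_tr => //; exact: smooth_frame.
by move=> i j; apply: smooth_on_sub (@smooth_gcoord a i j) => m [].
Qed.

Lemma smooth_clmx W (w : M -> 'cV[R]_2) : open W -> smooth_mx W w ->
  smooth_mx W (fun m => clmx sg (w m)).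
Proof.
move=> Wo ws i j.
have H mu : smooth_on W (fun m => (w m mu 0 *: Gam R sg mu) i j).
  by apply: smooth_mx_scale => //; exact: smooth_mx_cst.
by apply: smooth_on_eq (smooth_on_sum Wo H) => // m _; rewrite summxE.
Qed.

Lemma smooth_betamx vs W (w : M -> 'cV[R]_2) : open W -> smooth_mx W w ->
  smooth_mx W (fun m => betamx sg vs (w m)).
Proof.
move=> Wo ws; case: vs; apply: smooth_clmx => //.
by apply: smooth_mx_mul => //; exact: smooth_mx_cst.
Qed.

Lemma beta_b_endo_form vs b : smooth_on [set: M] b ->
  endo_form (beta_b vs (P := P) b).
Proof.
move=> bs; split; [exact: beta_b_linear|exact: beta_b_act|move=> t a k i j].
have Wo := open_tdom_dom t a.
have H : smooth_mx (tdom t `&` dom a)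
    (fun m => b m *: betamx sg vs (coframe t a m *m ebase R k)).
  apply: smooth_mx_scale => //; first by apply: smooth_on_sub bs.
  apply: smooth_betamx => //; apply: smooth_mx_mul => //; last exact: smooth_mx_cst.
  exact: smooth_coframe.
apply: smooth_on_eq (H i j) => // m [tm am].
by rewrite beta_bE coframeE// proj_sec// mulmxA.
Qed.

End orthonormal_frames.

(** * The Levi-Civita connection *)

Section levi_civita.
Context {R : realType} {sg : signature} {M : surface R}.
Variables (g : metric sg M) (m : M).
Implicit Types (v w : 'cV[R]_2) (X Y : M -> 'cV[R]_2).

Lemma gcoord_sym a m' : (gcoord g a m')^T = gcoord g a m'.
Proof. by rewrite /gcoord !trmx_mul trmxK gram_sym mulmxA. Qed.

Lemma gcoord_chart_at : gcoord g (chart_at m) m = g m.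
Proof.
by rewrite /gcoord jac_id ?trmx1 ?mul1mx ?mulmx1//; exact: dom_chart_at.
Qed.

Lemma tcoord_chart_at X : tcoord (chart_at m) X m = X m.
Proof. by rewrite /tcoord jac_id ?mul1mx//; exact: dom_chart_at. Qed.

Definition christoffel_mx v : 'M[R]_2 :=
  \matrix_(k, j) \sum_i christoffel g m k i j * v i 0.

Lemma nabla_vf_christoffel v Y : nabla_vf g m v Y =
  \col_k dir m v (fun m' => tcoord (chart_at m) Y m' k 0)
  + christoffel_mx v *m Y m.
Proof.
apply/matrixP => k j; rewrite ord1 !mxE; congr (_ + _).
rewrite exchange_big/=; apply: eq_bigr => i _.
by rewrite mxE big_distrl.
Qed.

Lemma nabla_vfE v Y dY :
  is_derive (chart (chart_at m) m) v (tcoord (chart_at m) Y \o param (chart_at m)) dY ->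
  nabla_vf g m v Y = dY + christoffel_mx v *m Y m.
Proof.
move=> /is_derive_mxP H; rewrite nabla_vf_christoffel; congr (_ + _).
by apply/matrixP => k j; rewrite ord1 mxE; have [_ <-] := H k 0.
Qed.

Let dg (l i j : 'I_2) :=
  dir m (ebase R l) (fun m' => gcoord g (chart_at m) m' i j).

Let dgC l i j : dg l i j = dg l j i.
Proof.
rewrite /dg; congr dir; apply/funext => m'.
by rewrite -[in LHS]gcoord_sym mxE.
Qed.

(** Torsion-freeness: the Christoffel formula is symmetric in its lower indices. *)
Lemma christoffel_mxC v w : christoffel_mx v *m w = christoffel_mx w *m v.
Proof.
have C k i j : christoffel g m k i j = christoffel g m k j i.
  rewrite /christoffel; congr (_ * _); apply: eq_bigr => l _; congr (_ * _).
  by rewrite -!/(dg _ _ _) (dgC l i j) (addrC (dg i j l)).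
apply/matrixP => k j; rewrite !mxE.
under eq_bigr do rewrite mxE big_distrl/=.
rewrite exchange_big/=; apply: eq_bigr => i _.
rewrite mxE big_distrl/=; apply: eq_bigr => l _.
by rewrite ord1 (C k i l) -!mulrA (mulrC (v i 0)).
Qed.

Lemma bracket_nabla X Y :
  bracket X Y m = nabla_vf g m (X m) Y - nabla_vf g m (Y m) X.
Proof.
rewrite !nabla_vf_christoffel (christoffel_mxC (Y m)) opprD addrACA subrr addr0.
by apply/matrixP => k j; rewrite !mxE.
Qed.

(** Christoffel symbols of the first kind: the Gram matrix cancels the inverse in [christoffel]. *)
Lemma lowered_christoffel v p j : (g m *m christoffel_mx v) p j
  = \sum_i v i 0 * (2^-1 * (dg i j p + dg j i p - dg p i j)).
Proof.
pose T i : 'cV[R]_2 := \col_l (2^-1 * (dg i j l + dg j i l - dg l i j)).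
have E k i : christoffel g m k i j = (invmx (g m) *m T i) k 0.
  rewrite /christoffel -!/(dg _ _ _) mxE big_distrr/=.
  by apply: eq_bigr => l _; rewrite mxE -!/(dg _ _ _) mulrCA.
have gu := gram_unit g m.
transitivity (\sum_i v i 0 * (g m *m (invmx (g m) *m T i)) p 0).
  rewrite mxE; under eq_bigr do rewrite mxE big_distrr/=.
  rewrite exchange_big/=; apply: eq_bigr => i _.
  rewrite [in RHS]mxE big_distrr/=; apply: eq_bigr => k _.
  by rewrite E; ring.
by apply: eq_bigr => i _; rewrite mulKVmx// mxE.
Qed.

Lemma christoffel_metric v :
  is_derive (chart (chart_at m) m) v (gcoord g (chart_at m) \o param (chart_at m))
    ((christoffel_mx v)^T *m g m + g m *m christoffel_mx v).
Proof.
have am := dom_chart_at m.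
have := smooth_mx_is_derive v (@smooth_gcoord _ _ _ g (chart_at m)) am am.
congr is_derive.
rewrite derive_mx; last first.
  exact: (smooth_mx_derivable (@smooth_gcoord _ _ _ g (chart_at m)) am am).
apply/matrixP => i j; rewrite [LHS]mxE.
rewrite derive_ebase; last first.
  exact: (smooth_on_differentiable (@smooth_gcoord _ _ _ g (chart_at m) i j) am am).
rewrite [RHS]mxE -[g m in X in X + _]gram_sym -trmx_mul [X in X + _]mxE.
rewrite !lowered_christoffel -big_split/=; apply: eq_bigr => l _.
rewrite (_ : 'D_(ebase R l) _ _ = dg l i j)// (dgC l j i).
by field.
Qed.

End levi_civita.

Section local_frames.
Context {R : realType} {sg : signature} {M : surface R} {g : metric sg M}.
Context {P : spin_structure g}.
Implicit Types (t : triv P) (a : atlas M) (m : M) (v w : 'cV[R]_2)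
  (psi : P -> 'cV[R]_2) (b : M -> R) (vs : symmetry).

Lemma frame_coord_chart_at t m :
  frame_coord t (chart_at m) m = frame (sec t m).
Proof. by rewrite /frame_coord jac_id ?mul1mx//; exact: dom_chart_at. Qed.

Lemma coframe_chart_at t m : tdom t m ->
  coframe t (chart_at m) m = invmx (frame (sec t m)).
Proof.
by move=> tm; rewrite coframeE ?jac_id ?mulmx1//; exact: dom_chart_at.
Qed.

Definition dframe t m v : 'M[R]_2 :=
  'D_v (frame_coord t (chart_at m) \o param (chart_at m)) (chart (chart_at m) m).

Lemma is_derive_frame t m v : tdom t m ->
  is_derive (chart (chart_at m) m) v
    (frame_coord t (chart_at m) \o param (chart_at m)) (dframe t m v).
Proof.
move=> tm; have am := dom_chart_at m.
exact: (smooth_mx_is_derive v (@smooth_frame _ _ _ _ P t _) am (conj tm am)).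
Qed.

Lemma gdot_col m (A Z : 'M[R]_2) mu nu :
  gdot g m (col mu A) (col nu Z) = (A^T *m g m *m Z) mu nu.
Proof.
rewrite /gdot tr_col -row_mul !mxE.
by apply: eq_bigr => k _; rewrite !mxE.
Qed.

Lemma conn_formE t m v : tdom t m -> conn_form t m v =
  (frame (sec t m))^T *m g m *m
    (dframe t m v + christoffel_mx g m v *m frame (sec t m)).
Proof.
move=> tm; apply/matrixP => mu nu; rewrite mxE.
suff -> : nabla_vf g m v (fun m' => col nu (frame (sec t m')))
    = col nu (dframe t m v + christoffel_mx g m v *m frame (sec t m)).
  by rewrite gdot_col.
transitivity (col nu (dframe t m v) + christoffel_mx g m v *m col nu (frame (sec t m))).
  apply: nabla_vfE; apply/is_derive_mxP => k j; rewrite mxE.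
  have /is_derive_mxP/(_ k nu) := is_derive_frame v tm.
  congr is_derive; apply/funext => y /=.
  by rewrite !mxE; apply: eq_bigr => l _; rewrite !mxE.
apply/matrixP => k j; rewrite !mxE; congr (_ + _).
by apply: eq_bigr => l _; rewrite !mxE.
Qed.

Lemma frame_conn_form t m v : tdom t m ->
  frame (sec t m) *m (eta_mx R sg *m conn_form t m v)
  = dframe t m v + christoffel_mx g m v *m frame (sec t m).
Proof.
move=> tm; rewrite conn_formE//.
have -> : g m = g (proj (sec t m)) by rewrite proj_sec.
by rewrite (mulmxA (eta_mx R sg)) -frame_inv mulKVmx ?frame_unit.
Qed.

Lemma conn_form_skew t m v : tdom t m ->
  (conn_form t m v)^T = - conn_form t m v.
Proof.
move=> tm; have am := dom_chart_at m.
have dE := is_derive_frame v tm.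
have D := is_derive_mulmx (is_derive_mulmx (is_derive_trmx dE)
  (christoffel_metric g m v)) dE.
have D0 : is_derive (chart (chart_at m) m) v (fun y =>
    ((frame_coord t (chart_at m) \o param (chart_at m)) y)^T
    *m (gcoord g (chart_at m) \o param (chart_at m)) y
    *m (frame_coord t (chart_at m) \o param (chart_at m)) y) 0.
  apply: near_eq_is_derive (is_derive_cst (eta_mx R sg) _ _).
  apply: filterS (near_chart (tdom_open t) am tm) => _ [m' [am' tm'] <-] /=.
  by rewrite chartK// frame_coord_orthonormal.
have := @derive_val _ _ _ _ _ _ _ D; rewrite (@derive_val _ _ _ _ _ _ _ D0) /=.
rewrite chartK// frame_coord_chart_at gcoord_chart_at => E.
apply/eqP; rewrite -addr_eq0 [X in _ == X]E conn_formE//; apply/eqP.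
rewrite !trmx_mul linearD/= !trmx_mul trmxK gram_sym.
rewrite !mulmxDl !mulmxDr !mulmxDl !mulmxA.
by rewrite !addrA [LHS]addrAC.
Qed.

Lemma coframe_structure t m v w : tdom t m ->
  'D_v (coframe t (chart_at m) \o param (chart_at m)) (chart (chart_at m) m) *m w
  + eta_mx R sg *m (conn_form t m v *m (invmx (frame (sec t m)) *m w))
  = invmx (frame (sec t m)) *m (christoffel_mx g m v *m w).
Proof.
move=> tm; have am := dom_chart_at m.
have fu := frame_unit (sec t m).
have dT := smooth_mx_is_derive v (@smooth_coframe _ _ _ _ P t _) am (conj tm am).
have D := is_derive_mulmx dT (is_derive_frame v tm).
have D0 : is_derive (chart (chart_at m) m) v (fun y =>
    (coframe t (chart_at m) \o param (chart_at m)) y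
    *m (frame_coord t (chart_at m) \o param (chart_at m)) y) 0.
  apply: near_eq_is_derive (is_derive_cst (1%:M : 'M[R]_2) _ _).
  apply: filterS (near_chart (tdom_open t) am tm) => _ [m' [am' tm'] <-] /=.
  by rewrite chartK// coframe_cancel.
have := @derive_val _ _ _ _ _ _ _ D; rewrite (@derive_val _ _ _ _ _ _ _ D0) /=.
set dT' := 'D_v _ _; rewrite chartK// frame_coord_chart_at coframe_chart_at//.
move=> /esym/eqP; rewrite addr_eq0 => /eqP E.
rewrite -[dT'](mulmxK fu) E.
have -> : eta_mx R sg *m (conn_form t m v *m (invmx (frame (sec t m)) *m w)) =
  invmx (frame (sec t m)) *m
    ((dframe t m v + christoffel_mx g m v *m frame (sec t m)) *m
     (invmx (frame (sec t m)) *m w)).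
  by rewrite -frame_conn_form// -!mulmxA mulKmx.
rewrite mulmxDl mulmxDr -[_ *m frame _ *m _]mulmxA mulKVmx//.
by rewrite !mulNmx !mulmxA addrA addNr add0r.
Qed.

End local_frames.

(** * Parallel spinors *)

Section bilinear_forms.
Context {R : realType}.
Implicit Types (sg : signature) (vs : symmetry) (e : 'cV[R]_2).

Lemma B_scaleB sg vs e k u w :
  B sg vs e (k *: u - w) = k * B sg vs e u - B sg vs e w.
Proof. by rewrite /B mulmxBr -scalemxAr !mxE. Qed.

Lemma B_addr sg vs e (u w : 'cV[R]_2) : B sg vs e (u + w) = B sg vs e u + B sg vs e w.
Proof. by rewrite /B mulmxDr mxE. Qed.

Lemma B_scaler sg vs e k u : B sg vs e (k *: u) = k * B sg vs e u.
Proof. by rewrite /B -scalemxAr mxE. Qed.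

Lemma betamxD sg vs (u w : 'cV[R]_2) :
  betamx sg vs (u + w) = betamx sg vs u + betamx sg vs w.
Proof. by rewrite -[u in LHS]scale1r betamx_linear scale1r. Qed.

Lemma betamxZ sg vs k (w : 'cV[R]_2) : betamx sg vs (k *: w) = k *: betamx sg vs w.
Proof.
have clmxZ u : clmx sg (k *: u) = k *: clmx sg u.
  by rewrite /clmx scaler_sumr; apply: eq_bigr => mu _; rewrite mxE scalerA.
by case: vs; rewrite /betamx -?scalemxAr clmxZ.
Qed.

Lemma current_scaleB sg vs e k u w :
  current sg vs e (k *: u - w) = k *: current sg vs e u - current sg vs e w.
Proof. by apply/matrixP => mu j; rewrite !mxE mulmxBr -scalemxAr B_scaleB. Qed.

Lemma B_mulmxC sg vs (A : 'M[R]_2) e e' :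
  (Bmx R sg vs *m A)^T = Bmx R sg vs *m A -> B sg vs e (A *m e') = B sg vs e' (A *m e).
Proof.
move=> sA; rewrite !B_mulmx -[in LHS](trmxK (e^T *m _ *m e')) mxE 2!trmx_mul trmxK.
by rewrite sA mulmxA.
Qed.

Lemma is_derive_B (V : normedModType R) sg vs (F G : V -> 'cV[R]_2) x v dF dG :
  is_derive x v F dF -> is_derive x v G dG ->
  is_derive x v (fun y => B sg vs (F y) (G y)) (B sg vs dF (G x) + B sg vs (F x) dG).
Proof.
move=> dFx dGx; rewrite /B.
have := is_derive_mulmx (is_derive_mulmx (is_derive_trmx dFx)
  (is_derive_cst (Bmx R sg vs) x v)) dGx.
move=> /is_derive_mxP/(_ 0 0)/is_derive_eq; apply.
by rewrite mxE mulmx0 addr0.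
Qed.

Lemma B_so_act sg vs (W : 'M[R]_2) e e' :
  B sg vs (so_act sg W *m e) e' = - B sg vs e (so_act sg W *m e').
Proof.
have /eqP := so_act_Bmx sg vs W; rewrite addr_eq0 => /eqP E.
by rewrite /B trmx_mul -[e^T *m (so_act sg W)^T *m _]mulmxA E mulmxN mulNmx mxE !mulmxA.
Qed.

Lemma is_derive_mulmxl (V : normedModType R) m n p (A : 'M[R]_(m, n))
    (F : V -> 'M[R]_(n, p)) x v dF :
  is_derive x v F dF -> is_derive x v (fun y => A *m F y) (A *m dF).
Proof.
move=> dFx; apply: is_derive_eq (is_derive_mulmx (is_derive_cst A x v) dFx) _.
by rewrite mul0mx add0r.
Qed.

Lemma is_derive_current (V : normedModType R) sg vs (F : V -> 'cV[R]_2) x v dF :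
  is_derive x v F dF -> is_derive x v (fun y => current sg vs (F y) (F y))
    (2 *: current sg vs (F x) dF).
Proof.
move=> dFx; apply/is_derive_mxP => mu j.
have D := is_derive_B sg vs dFx (is_derive_mulmxl (Gam R sg mu) dFx).
have -> : (fun y => current sg vs (F y) (F y) mu j)
    = (fun y => B sg vs (F y) (Gam R sg mu *m F y)).
  by apply/funext => y; rewrite mxE.
apply: is_derive_eq D _; rewrite !mxE.
rewrite -clmx_delta B_mulmxC ?Bmx_clmx_sym//.
by rewrite -mulr2n mulr_natl.
Qed.

Lemma is_derive_clmx (V : normedModType R) sg (w : V -> 'cV[R]_2) x v dw :
  is_derive x v w dw -> is_derive x v (fun y => clmx sg (w y)) (clmx sg dw).
Proof.
move=> /is_derive_mxP dwx; apply: is_derive_big_sum => mu.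
apply: is_derive_eq (is_derive_scalemx (dwx mu 0) (is_derive_cst (Gam R sg mu) x v)) _.
by rewrite scaler0 addr0.
Qed.

Lemma is_derive_betamx (V : normedModType R) sg vs (w : V -> 'cV[R]_2) x v dw :
  is_derive x v w dw -> is_derive x v (fun y => betamx sg vs (w y)) (betamx sg vs dw).
Proof.
case: vs => dwx; apply: is_derive_clmx => //.
exact: is_derive_mulmxl.
Qed.

End bilinear_forms.

Section spinors.
Context {R : realType} {sg : signature} {M : surface R} {g : metric sg M}.
Context {P : spin_structure g}.
Implicit Types (t : triv P) (a : atlas M) (m : M) (v w : 'cV[R]_2)
  (psi : P -> 'cV[R]_2) (b : M -> R) (vs : symmetry).

Lemma smooth_spinor psi t : spinor_field psi ->
  smooth_mx (tdom t) (fun m => psi (sec t m)).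
Proof. by move=> [_ ps] k j; rewrite ord1; exact: ps. Qed.

Lemma nabla_spinorE psi t m v dpsi :
  is_derive (chart (chart_at m) m) v
    ((fun m' => psi (sec t m')) \o param (chart_at m)) dpsi ->
  nabla_spinor t m v psi = dpsi + so_act sg (conn_form t m v) *m psi (sec t m).
Proof.
move=> /is_derive_mxP H; congr (_ + _); apply/matrixP => k j.
by rewrite ord1 mxE; have [_ <-] := H k 0.
Qed.

Lemma is_derive_change_chart (F : M -> 'cV[R]_2) a c m v dF :
  dom a m -> dom c m ->
  (forall i, differentiable ((fun m' => F m' i 0) \o param a) (chart a m)) ->
  is_derive (chart c m) (jac a c m *m v) (F \o param c) dF ->
  is_derive (chart a m) v (F \o param a) dF.
Proof.
move=> am cm Fd /is_derive_mxP dFc; apply/is_derive_mxP => i j; rewrite ord1.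
apply: DeriveDef; first by apply: diff_derivable; exact: Fd.
have [_ <-] := dFc i 0.
rewrite [RHS](derive_change_chart _ am cm (Fd i)) mulmxA jac_cancel// mul1mx//.
Qed.

Section parallel_spinor.
Context {vs : symmetry} {b : M -> R} {psi : P -> 'cV[R]_2}.
Hypothesis psi_parallel : parallel (beta_b vs b) psi.

Lemma parallel_derive_chart_at t m v : tdom t m ->
  is_derive (chart (chart_at m) m) v
    ((fun m' => psi (sec t m')) \o param (chart_at m))
    (b m *: (betamx sg vs (invmx (frame (sec t m)) *m v) *m psi (sec t m))
     - so_act sg (conn_form t m v) *m psi (sec t m)).
Proof.
move=> tm; have [ps pp] := psi_parallel.
have am := dom_chart_at m.
have D := smooth_mx_is_derive v (smooth_spinor t ps) am tm.
apply: (is_derive_eq D); have := pp t m v tm.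
rewrite /conn_D (nabla_spinorE D) beta_bE proj_sec// -scalemxAl.
by move/subr0_eq <-; rewrite addrK.
Qed.

Lemma parallel_derive t a m v : tdom t m -> dom a m ->
  exists W, is_derive (chart a m) v ((fun m' => psi (sec t m')) \o param a)
    (b m *: (betamx sg vs (coframe t a m *m v) *m psi (sec t m))
     - so_act sg W *m psi (sec t m)).
Proof.
move=> tm am; have [ps _] := psi_parallel.
exists (conn_form t m (jac a (chart_at m) m *m v)).
have := parallel_derive_chart_at (jac a (chart_at m) m *m v) tm.
rewrite mulmxA -coframeE//; apply: is_derive_change_chart => //.
  exact: dom_chart_at.
by move=> i; exact: smooth_on_differentiable (smooth_spinor t ps i 0) am tm.
Qed.

Lemma tcoord_kappa_vf t a m : tdom t m -> dom a m ->
  tcoord a (kappa_vf vs psi) m = frame_coord t a m *m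
    (eta_mx R sg *m current sg vs (psi (sec t m)) (psi (sec t m))).
Proof.
move=> tm am; have [[pe _] _] := psi_parallel.
rewrite /tcoord /frame_coord -mulmxA; congr (_ *m _).
have pE : proj (sec t m) = proj (sec (triv_at P m) m).
  by rewrite !proj_sec//; exact: tdom_triv_at.
have [s [[ss qE] _]] := act_simply_transitive pE.
by rewrite /kappa_vf qE pe// kappa_act// kappaE.
Qed.

Lemma kappa_vfE t m : tdom t m -> kappa_vf vs psi m =
  frame (sec t m) *m (eta_mx R sg *m current sg vs (psi (sec t m)) (psi (sec t m))).
Proof.
move=> tm; rewrite -frame_coord_chart_at -tcoord_kappa_vf ?tcoord_chart_at//.
exact: dom_chart_at.
Qed.

Definition dkappa t m v : 'cV[R]_2 :=
  frame (sec t m) *m (eta_mx R sg *m ((2 * b m) *: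
    (dcurrent sg vs (psi (sec t m)) *m (invmx (frame (sec t m)) *m v)))).

Lemma kappa_vf_derive t m v : tdom t m ->
  is_derive (chart (chart_at m) m) v
    (tcoord (chart_at m) (kappa_vf vs psi) \o param (chart_at m))
    (dkappa t m v - christoffel_mx g m v *m kappa_vf vs psi m).
Proof.
move=> tm; have am := dom_chart_at m.
have D := is_derive_mulmx (is_derive_frame v tm) (is_derive_mulmxl (eta_mx R sg)
  (is_derive_current sg vs (parallel_derive_chart_at v tm))).
apply: (near_eq_is_derive _ (is_derive_eq D _)).
  apply: filterS (near_chart (tdom_open t) am tm) => _ [m' [am' tm'] <-] /=.
  by rewrite chartK// (tcoord_kappa_vf tm').
rewrite /= chartK// frame_coord_chart_at (kappa_vfE tm).
rewrite current_scaleB scalerBr scalerA current_so_act ?conn_form_skew//.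
rewrite 2!mulmxBr (mulmxA (eta_mx R sg) (conn_form _ _ _)).
rewrite (mulmxA (frame _) (eta_mx _ _ *m conn_form _ _ _)) frame_conn_form//.
rewrite /dkappa dcurrent_mul mulmxDl -!mulmxA.
by rewrite addrCA opprD addNKr.
Qed.

Lemma nabla_kappa_vf t m v : tdom t m ->
  nabla_vf g m v (kappa_vf vs psi) = dkappa t m v.
Proof. by move=> tm; rewrite (nabla_vfE g (kappa_vf_derive v tm)) subrK. Qed.

Lemma dkappa_frame t m w : tdom t m ->
  (frame (sec t m))^T *m g m *m dkappa t m (frame (sec t m) *m w)
  = (2 * b m) *: (dcurrent sg vs (psi (sec t m)) *m w).
Proof.
move=> tm; have fu := frame_unit (sec t m).
have -> : g m = g (proj (sec t m)) by rewrite proj_sec.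
rewrite -[_ *m g _]mul1mx -(eta_mxK sg) -[_ *m _ *m (_ *m g _)]mulmxA -frame_inv.
by rewrite /dkappa -!mulmxA !(mulKmx fu) mulmxA eta_mxK mul1mx.
Qed.

Lemma lowered_nabla_kappa t m : tdom t m ->
  lowered (sec t m) (fun v => nabla_vf g m v (kappa_vf vs psi))
  = (2 * b m) *: dcurrent sg vs (psi (sec t m)).
Proof.
move=> tm; apply/matrixP => mu nu.
rewrite mxE (nabla_kappa_vf _ tm) proj_sec// [col nu _]colE.
transitivity (((frame (sec t m))^T *m g m
  *m dkappa t m (frame (sec t m) *m delta_mx nu 0)) mu 0).
  by rewrite /gdot tr_col -!row_mul mxE.
by rewrite dkappa_frame// -colE !mxE.
Qed.

(* Differentiating the scalar [B psi psi] for the symmetric form [B] does not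
   involve the connection, so its second derivatives only involve the torsion
   of the coframe. *)
Lemma derive_norm t a m v : tdom t m -> dom a m ->
  'D_v ((fun m' => B sg Symmetric (psi (sec t m')) (psi (sec t m'))) \o param a)
    (chart a m)
  = 2 * (b m * B sg Symmetric (psi (sec t m))
      (betamx sg vs (coframe t a m *m v) *m psi (sec t m))).
Proof.
move=> tm am; have [W D] := parallel_derive v tm am.
rewrite (@derive_val _ _ _ _ _ _ _ (is_derive_B sg Symmetric D D)) /= chartK//.
have BC e e' : B sg Symmetric e e' = B sg Symmetric e' e.
  rewrite -[e']mul1mx B_mulmxC ?mul1mx//.
  rewrite mulmx1; case: sg; rewrite /Bmx ?trmx1// /sigma1 mx22_tr//.
rewrite [X in X + _]BC !B_scaleB.
set p := psi _; have Z : B sg Symmetric p (so_act sg W *m p) = 0.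
  have := B_so_act sg Symmetric W p p; rewrite BC => /eqP.
  by rewrite -addr_eq0 -mulr2n mulrn_eq0 => /eqP.
by rewrite Z subr0 -mulr2n mulr_natl.
Qed.

End parallel_spinor.
End spinors.

(** * Invariance of the connection form *)

Lemma derive_lincomb (R : realType) (V : normedModType R) (f : V -> R) (x u v : V) k l :
  differentiable f x -> 'D_(k *: u + l *: v) f x = k * 'D_u f x + l * 'D_v f x.
Proof. by move=> fx; rewrite !deriveE// linearP linearZ. Qed.

Section invariance.
Context {R : realType} {sg : signature} {M : surface R} {g : metric sg M}.
Context {P : spin_structure g} {vs : symmetry} {b : M -> R}.
Implicit Types (t : triv P) (a : atlas M) (m : M) (u v w : 'cV[R]_2).
Hypothesis b_smooth : smooth_on [set: M] b.

Let diff_b a m : dom a m -> differentiable (b \o param a) (chart a m).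
Proof. by move=> am; exact: smooth_on_differentiable b_smooth am I. Qed.

Let db m v := 'D_v (b \o param (chart_at m)) (chart (chart_at m) m).

Let is_derive_b m v :
  is_derive (chart (chart_at m) m) v (b \o param (chart_at m)) (db m v).
Proof.
by apply: derivableP; apply: diff_derivable; apply: diff_b; exact: dom_chart_at.
Qed.

Let is_derive_coframe t m v dw (W : 'cV[R]_2 -> 'cV[R]_2) : tdom t m ->
  is_derive (chart (chart_at m) m) v W dw ->
  is_derive (chart (chart_at m) m) v
    (fun y => b (param (chart_at m) y) *:
       betamx sg vs (coframe t (chart_at m) (param (chart_at m) y) *m W y))
    (db m v *: betamx sg vs (invmx (frame (sec t m)) *m W (chart (chart_at m) m))
     + b m *: betamx sg vs (
       'D_v (coframe t (chart_at m) \o param (chart_at m)) (chart (chart_at m) m)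
         *m W (chart (chart_at m) m)
       + invmx (frame (sec t m)) *m dw)).
Proof.
move=> tm dW; have am := dom_chart_at m.
have dT := smooth_mx_is_derive v (@smooth_coframe _ _ _ _ P t _) am (conj tm am).
have := is_derive_scalemx (is_derive_b m v)
  (is_derive_betamx sg vs (is_derive_mulmx dT dW)).
by rewrite /= chartK// coframe_chart_at.
Qed.

Section parallel_spinor.
Context {psi : P -> 'cV[R]_2}.
Hypothesis psi_parallel : parallel (beta_b vs b) psi.

Let Q t m w := B sg Symmetric (psi (sec t m)) (betamx sg vs w *m psi (sec t m)).

Let derive_Q t m u v : tdom t m ->
  is_derive (chart (chart_at m) m) u
    (fun y => B sg Symmetric (psi (sec t (param (chart_at m) y)))
      ((b (param (chart_at m) y) *:
        betamx sg vs (coframe t (chart_at m) (param (chart_at m) y) *m v))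
        *m psi (sec t (param (chart_at m) y))))
    (db m u * Q t m (invmx (frame (sec t m)) *m v)
     + b m * Q t m (invmx (frame (sec t m)) *m (christoffel_mx g m u *m v))
     + 2 * b m ^+ 2 * B sg Symmetric (psi (sec t m))
        (betamx sg vs (invmx (frame (sec t m)) *m v) *m
         (betamx sg vs (invmx (frame (sec t m)) *m u) *m psi (sec t m)))).
Proof.
move=> tm; have dpsi := parallel_derive_chart_at psi_parallel u tm.
have dN := is_derive_coframe tm (is_derive_cst v (chart (chart_at m) m) u).
have am := dom_chart_at m.
have D := is_derive_B sg Symmetric dpsi (is_derive_mulmx dN dpsi).
apply: (is_derive_eq D); rewrite /= chartK// coframe_chart_at// mulmx0 addr0.
rewrite /Q -(coframe_structure u v tm).
set T := invmx _; set p := psi _; set dT := 'D_u _ _; set S := so_act _ _.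
set N := betamx sg vs (T *m v).
have NC e : B sg Symmetric e ((b m *: N) *m p) = b m * B sg Symmetric p (N *m e).
  by rewrite -scalemxAl B_scaler B_mulmxC ?Bmx_betamx_sym.
have := B_betamx_so_act sg vs (T *m v) p (conn_form_skew u tm).
rewrite -/N -/S NC => E.
clearbody S N.
rewrite !betamxD !mulmxDl !B_addr -!scalemxAl !B_scaler mulmxBr -scalemxAr B_scaleB.
by move: E => /(congr1 -%R); rewrite opprK => <-; ring.
Qed.

Lemma derive_b_comm t m u v : tdom t m ->
  'D_u (b \o param (chart_at m)) (chart (chart_at m) m)
    * B sg Symmetric (psi (sec t m))
      (betamx sg vs (invmx (frame (sec t m)) *m v) *m psi (sec t m)) =
  'D_v (b \o param (chart_at m)) (chart (chart_at m) m)
    * B sg Symmetric (psi (sec t m))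
      (betamx sg vs (invmx (frame (sec t m)) *m u) *m psi (sec t m)).
Proof.
move=> tm; have am := dom_chart_at m; have [ps _] := psi_parallel.
rewrite -/(db m u) -/(db m v) -/(Q t m _) -/(Q t m _).
pose norm m' := B sg Symmetric (psi (sec t m')) (psi (sec t m')).
pose f := norm \o param (chart_at m).
have norm_smooth : smooth_on (tdom t) norm.
  have s := smooth_spinor t ps.
  have := smooth_mx_mul (tdom_open t) (smooth_mx_mul (tdom_open t)
    (smooth_mx_tr (tdom_open t) s) (smooth_mx_cst _ (Bmx R sg Symmetric))) s.
  by move=> /(_ 0 0).
have second k l : 'D_(ebase R l) ('D_(ebase R k) f) (chart (chart_at m) m)
    = 2 * (db m (ebase R l) * Q t m (invmx (frame (sec t m)) *m ebase R k)
     + b m * Q t m (invmx (frame (sec t m)) *m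
         (christoffel_mx g m (ebase R l) *m ebase R k))
     + 2 * b m ^+ 2 * B sg Symmetric (psi (sec t m))
        (betamx sg vs (invmx (frame (sec t m)) *m ebase R k) *m
         (betamx sg vs (invmx (frame (sec t m)) *m ebase R l) *m psi (sec t m)))).
  have [_ E] := is_deriveZ (2 : R) (derive_Q (ebase R l) (ebase R k) tm).
  apply: etrans E; apply: near_eq_derive.
  apply: filterS (near_chart (tdom_open t) am tm) => _ [m' [am' tm'] <-].
  by rewrite /f (derive_norm psi_parallel _ tm' am') /= -scalemxAl B_scaler chartK.
have Oo := @open_chart_image _ _ (chart_at m) _ (tdom_open t).
have Ox : (chart (chart_at m) @` (dom (chart_at m) `&` tdom t)) (chart (chart_at m) m).
  by exists m.
have basis k l : db m (ebase R l) * Q t m (invmx (frame (sec t m)) *m ebase R k)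
  = db m (ebase R k) * Q t m (invmx (frame (sec t m)) *m ebase R l).
  have := Ck2_comm k l Oo (norm_smooth (chart_at m) 2) Ox.
  rewrite -/f !second (christoffel_mxC g m (ebase R l)) B_betamx2C.
  have n2 : (2 : R) != 0 by rewrite pnatr_eq0.
  by move=> /(mulfI n2)/addIr/addIr.
have db_sum w : db m w = \sum_k w k 0 * db m (ebase R k) by exact/derive_ebase/diff_b.
have Q_sum w : Q t m (invmx (frame (sec t m)) *m w)
    = \sum_k w k 0 * Q t m (invmx (frame (sec t m)) *m ebase R k).
  rewrite [in LHS](col_sum_ebase w) !sum2 mulmxDr -!scalemxAr /Q.
  by rewrite betamxD !betamxZ mulmxDl B_addr -!scalemxAl !B_scaler.
rewrite !db_sum !Q_sum !sum2; have := basis 0 1.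
move: (db m (ebase R 0)) (db m (ebase R 1)) => d0 d1.
move: (Q t m (_ *m ebase R 0)) (Q t m (_ *m ebase R 1)) => Q0 Q1 E.
apply/eqP; rewrite -subr_eq0.
have -> : (u 0 0 * d0 + u 1 0 * d1) * (v 0 0 * Q0 + v 1 0 * Q1)
    - (v 0 0 * d0 + v 1 0 * d1) * (u 0 0 * Q0 + u 1 0 * Q1)
    = (u 1 0 * v 0 0 - u 0 0 * v 1 0) * (d1 * Q0 - d0 * Q1) by ring.
by rewrite E subrr mulr0.
Qed.

Lemma derive_b_kappa t m : tdom t m ->
  'D_(kappa_vf vs psi m) (b \o param (chart_at m)) (chart (chart_at m) m) = 0.
Proof.
move=> tm; have fu := frame_unit (sec t m).
have bd := diff_b (dom_chart_at m).
have [c cE] := @current_dual R sg vs; rewrite (kappa_vfE psi_parallel tm) cE.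
rewrite -/(db m _) -!/(Q t m _).
set Q0 := Q t m _; set Q1 := Q t m _.
have -> : cv2 (c * Q0) (- c * Q1) = (c * Q0) *: cv2 1 0 + (- c * Q1) *: cv2 0 1.
  by rewrite !cv2Z cv2D; congr cv2; ring.
rewrite mulmxDr -!scalemxAr /db derive_lincomb// -!/(db m _).
have := derive_b_comm (frame (sec t m) *m cv2 1 0) (frame (sec t m) *m cv2 0 1) tm.
rewrite !mulKmx// -!/(db m _) -/Q0 -/Q1 => E.
by rewrite mulNr mulNr -!mulrA [Q0 * _]mulrC [Q1 * _]mulrC E subrr.
Qed.

Lemma lie_form_beta_b t m (Y : M -> 'cV[R]_2) (phi : P -> 'cV[R]_2) :
  smooth_vf setT Y -> spinor_field phi -> tdom t m ->
  lie_form (kappa_vf vs psi) (beta_b vs b) Y t m phi = 0.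
Proof.
move=> Ys phis tm; have am := dom_chart_at m; have fu := frame_unit (sec t m).
set X := kappa_vf vs psi; set p := phi (sec t m).
have Ysm : smooth_mx (setT `&` dom (chart_at m)) (tcoord (chart_at m) Y).
  by move=> k j; rewrite ord1; exact: Ys.
have dY := smooth_mx_is_derive (X m) Ysm am (conj I am).
have dphi := smooth_mx_is_derive (X m) (smooth_spinor t phis) am tm.
set T := invmx (frame (sec t m)).
set dY' := 'D_(X m) (tcoord _ Y \o _) _ in dY.
set dp := 'D_(X m) _ _ in dphi.
set dT := 'D_(X m) (coframe t (chart_at m) \o param (chart_at m)) (chart (chart_at m) m).
have bX : db m (X m) = 0 := derive_b_kappa tm.
have D : is_derive (chart (chart_at m) m) (X m)
    ((fun m' => beta_b vs b (sec t m') (Y (proj (sec t m'))) *m phi (sec t m'))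
      \o param (chart_at m))
    ((b m *: betamx sg vs (dT *m Y m + T *m dY')) *m p
     + (b m *: betamx sg vs (T *m Y m)) *m dp).
  have := is_derive_mulmx (is_derive_coframe tm dY) dphi.
  rewrite /= chartK// bX scale0r add0r tcoord_chart_at.
  rewrite coframe_chart_at//; apply: near_eq_is_derive.
  apply: filterS (near_chart (tdom_open t) am tm) => _ [m' [am' tm'] <-] /=.
  rewrite chartK// proj_sec// beta_bE proj_sec// coframeE// /tcoord.
  by rewrite -mulmxA (mulmxA (jac _ _ _)) jac_cancel ?mul1mx//; exact: dom_chart_at.
set W := conn_form t m (X m) - (2 * b m) *: dcurrent sg vs (psi (sec t m)).
have Wskew : W^T = - W.
  by rewrite linearB/= linearZ/= conn_form_skew// dcurrent_skew opprB addrC scalerN opprK.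
have structure : dT *m Y m + T *m dY' + eta_mx R sg *m (W *m (T *m Y m))
    = T *m bracket X Y m.
  rewrite (bracket_nabla g) (nabla_vfE g dY) (nabla_kappa_vf psi_parallel _ tm).
  rewrite mulmxBr (mulKmx fu) mulmxDr -(coframe_structure _ _ tm) -/T -/dT.
  rewrite mulmxBl -scalemxAl mulmxBr addrA; congr (_ - _).
  by rewrite addrCA addrA.
set A := dT *m Y m + T *m dY' in D structure.
rewrite /lie_form /lie_spinor (nabla_spinorE D) (nabla_spinorE dphi).
rewrite (lowered_nabla_kappa psi_parallel tm) !beta_bE proj_sec// -structure.
clearbody A; rewrite -/T -/p -/X betamxD -so_act_betamx//.
have -> : so_act sg W = so_act sg (conn_form t m (X m))
    - so_act sg ((2 * b m) *: dcurrent sg vs (psi (sec t m))).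
  by rewrite !so_actE -scalerBl -mulrBr; congr ((_ * _) *: _); rewrite !mxE; ring.
set S1 := so_act _ _; set S2 := so_act _ _; set N := betamx sg vs (T *m Y m).
clearbody S1 S2 N.
rewrite -!scalemxAl -!scalemxAr !(mulmxDl, mulmxDr, mulNmx, mulmxN) -!mulmxA.
apply/matrixP => i j; rewrite ord1.
move: (betamx sg vs A *m p) (N *m dp) (S1 *m (N *m p)) (S2 *m (N *m p))
  (N *m (S1 *m p)) (N *m (S2 *m p)) => c1 c2 c3 c4 c5 c6.
by rewrite !mxE; ring.
Qed.

End parallel_spinor.
End invariance.

Theorem proposition4p3 (R : realType) (sg : signature) (M : surface R)
  (g : metric sg M) (P : spin_structure g) (vs : symmetry) (b : M -> R)
  (M_connected : connected [set: M]%classic)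
  (b_smooth : smooth_on [set: M]%classic b) :
  admissible vs (beta_b vs (P := P) b).
Proof.
split; first exact: beta_b_endo_form.
- by move=> psi p X Y _; exact: gamma_skew.
- by move=> psi p _; exact: beta_gamma_cancel.
- by move=> psi psi_parallel Y phi t m Ys phis tm; exact: lie_form_beta_b.
Qed.
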